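(* Suppose Assumptions (A), (B), (D), (E), (F) of the context hold. Let $(\lambda_t,\beta_t)$ be generated by the OBBO algorithm described in the context, with window size $w\ge 1$, inner step size $0<\eta<\min\left(\frac{1}{\ell_{g,1}},\frac{1}{\mu_g}\right)$, outer step size $$0<\alpha\le\min\left\{\frac{3\rho}{4\ell_{F,1}},\ \frac{\rho\sqrt{1-\nu}}{\kappa_g\sqrt{108\,C_{\mu_g}L_{\beta}}}\right\},$$ and inner iteration count $$K=\left\lceil\frac{\log T}{\log\left((1-\eta\mu_g)^{-1}\right)}\right\rceil+1.$$ Then the bilevel local regret of OBBO satisfies $$BLR_w(T):=\sum_{t=1}^T\left\|\mathcal G_{\mathcal X,t}\big(\lambda_t,\nabla F_{t,w}(\lambda_t),\alpha\big)\right\|^2\le O\left(\frac{T}{w}+V_{1,T}+\kappa_g^2H_{2,T}\right).$$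
   Context: **Problem.** Online bilevel optimization over $t=1,\dots,T$ (functions for $t=T+1$ are also given wherever they appear). $\mathcal X\subseteq\mathbb R^{d_1}$; $f_t,g_t:\mathcal X\times\mathbb R^{d_2}\to\mathbb R$; $h$ is a convex, possibly nonsmooth, function on $\mathcal X$. $\widehat\beta_t(\lambda):=\arg\min_{\beta\in\mathbb R^{d_2}}g_t(\lambda,\beta)$ and $F_t(\lambda):=f_t(\lambda,\widehat\beta_t(\lambda))$. $\|\cdot\|$ is the $\ell_2$ norm (spectral norm for matrices). **Assumptions.** (A) For all $t$: $f_t$ is $\ell_{f,0}$-Lipschitz, $\nabla f_t$ is $\ell_{f,1}$-Lipschitz, $\nabla g_t$ is $\ell_{g,1}$-Lipschitz, and $\nabla^2_{\lambda,\beta}g_t$, $\nabla^2_{\beta,\beta}g_t$ are both $\ell_{g,2}$-Lipschitz, on $\mathcal X\times\mathbb R^{d_2}$. (B) $g_t(\lambda,\cdot)$ is $\mu_g$-strongly convex for all $t$ and all $\lambda\in\mathcal X$. (D) $\mathcal X$ is closed, convex and bounded with $\|\lambda_1-\lambda_2\|\le S$ for all $\lambda_1,\lambda_2\in\mathcal X$. (E) $\sup_{\lambda\in\mathcal X}|F_t(\lambda)|\le Q<\infty$ for all $t$. (F) For all $t$ the distance generating function $\phi_t:\mathcal X\to\mathbb R$ is continuously differentiable and $\rho$-strongly convex with respect to $\|\cdot\|$. **Bregman step.** $\mathcal D_{\phi}(\lambda_2,\lambda_1):=\phi(\lambda_2)-\phi(\lambda_1)-\langle\nabla\phi(\lambda_1),\lambda_2-\lambda_1\rangle$.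 For $u\in\mathcal X$, $q\in\mathbb R^{d_1}$, $\alpha>0$ let $\lambda^+:=\arg\min_{\lambda\in\mathcal X}\{\langle q,\lambda\rangle+h(\lambda)+\frac1\alpha\mathcal D_{\phi_t}(\lambda,u)\}$ and define the generalized projection $\mathcal G_{\mathcal X,t}(u,q,\alpha):=\frac1\alpha(u-\lambda^+)$. **OBBO algorithm.** Start from $\lambda_1\in\mathcal X$, $\beta_1\in\mathbb R^{d_2}$. For $t=1,\dots,T$: set $\omega_t^0=\beta_t$; for $k=1,\dots,K$ set $\omega_t^k=\omega_t^{k-1}-\eta\nabla_{\omega}g_t(\lambda_t,\omega_t^{k-1})$; set $\beta_{t+1}=\omega_t^K$; form the hypergradient estimate $$\frac{\partial f_t(\lambda_t,\omega_t^K)}{\partial\lambda}:=\nabla_\lambda f_t(\lambda_t,\omega_t^K)-\eta\sum_{k=0}^{K-1}\nabla^2_{\lambda,\omega}g_t(\lambda_t,\omega_t^k)\prod_{j=k+1}^{K-1}\left(I_{d_2}-\eta\nabla^2_{\omega,\omega}g_t(\lambda_t,\omega_t^j)\right)\nabla_\omega f_t(\lambda_t,\omega_t^K);$$ form the window average $\frac{\partial f_{t,w}(\lambda_t,\omega_t^K)}{\partial\lambda}:=\frac1w\sum_{i=0}^{w-1}\frac{\partial f_{t-i}(\lambda_{t-i},\omega_{t-i}^K)}{\partial\lambda}$; and set $\lambda_{t+1}=\arg\min_{\lambda\in\mathcal X}\{\langle\frac{\partial f_{t,w}(\lambda_t,\omega_t^K)}{\partial\lambda},\lambda\rangle+h(\lambda)+\frac1\alpha\mathcal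 D_{\phi_t}(\lambda,\lambda_t)\}$. Convention: $f_t=F_t=0$ for $t\le0$. **Time smoothing.** $F_{t,w}(\lambda_t):=\frac1w\sum_{i=0}^{w-1}F_{t-i}(\lambda_{t-i})$ and $\nabla F_{t,w}(\lambda_t):=\frac1w\sum_{i=0}^{w-1}\nabla F_{t-i}(\lambda_{t-i})$. **Variation measures.** $V_{1,T}:=\sum_{t=1}^T\sup_{\lambda\in\mathcal X}|F_{t+1}(\lambda)-F_t(\lambda)|$, $H_{2,T}:=\sum_{t=2}^T\sup_{\lambda\in\mathcal X}\|\widehat\beta_{t-1}(\lambda)-\widehat\beta_t(\lambda)\|^2$. **Constants.** $\kappa_g:=\ell_{g,1}/\mu_g$; $M_f:=\ell_{f,1}+\ell_{f,1}\kappa_g+\frac{\ell_{f,0}\ell_{g,2}}{\mu_g}(1+\kappa_g)$; $\ell_{F,1}:=\ell_{f,1}(1+\kappa_g)+\frac{\ell_{f,0}\ell_{g,2}}{\mu_g}(1+\kappa_g)+M_f\kappa_g$ (a Lipschitz constant of $\nabla F_t$); $\nu:=\left(1-\frac{\eta\mu_g}{2}\right)(1-\eta\mu_g)^{K-1}$; $C_{\mu_g}:=1+\frac{2}{\eta\mu_g}$; $L_1:=\kappa_g(\ell_{g,1}+\mu_g)$; $L_2:=\frac{2\ell_{f,0}\ell_{g,2}}{\mu_g}(1+\kappa_g)$; $L_\beta:=L_1^2(1-\eta\mu_g)^K+L_2^2(1-\eta\mu_g)^{K-1}$. The $O(\cdot)$ rate is reported in terms of the number of rounds $T$, the window $w$,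 the comparator sequences $V_{1,T},H_{2,T}$ and the condition number $\kappa_g$.
   Formalization: The constant in O(·) is uniform only for windows w at most r·T, for an arbitrary fixed r; with w unrestricted the bound fails (all f_t zero, h not minimal at the starting point, w much larger than T). The constant may also depend on α and on a bound for the initial inner error. *)

(* Defs.v *)
From HB Require Import structures.
From mathcomp Require Export all_boot all_order all_algebra.
From mathcomp Require Export all_classical all_reals all_analysis.

Set Implicit Arguments.
Unset Strict Implicit.
Unset Printing Implicit Defensive.
Import Order.TTheory GRing.Theory Num.Theory.
Import numFieldNormedType.Exports.

Local Open Scope classical_set_scope.
Local Open Scope ring_scope.

(* Vectors of R^n are columns.  A point (lambda, beta) of R^d1 x R^d2 is the
   stacked column [col_mx lambda beta], so its l2 norm is the joint l2 norm. *)

Section Euclidean.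
Variable R : realType.
Implicit Types n m : nat.

Definition dotp n (u v : 'cV[R]_n) : R := \sum_i u i 0 * v i 0.

(* The library norm on matrices is the sup norm, hence these two. *)
Definition l2norm n (u : 'cV[R]_n) : R := Num.sqrt (dotp u u).

Definition spectral_norm m n (A : 'M[R]_(m, n)) : R :=
  sup [set l2norm (A *m x) | x in [set x : 'cV[R]_n | l2norm x <= 1]].

(* Derivatives are taken relative to the domain D, since the functions are only
   given on D.  If D has empty interior, v (or J) is not unique. *)
Definition is_grad_on n (D : set 'cV[R]_n) (f : 'cV[R]_n -> R)
    (x v : 'cV[R]_n) : Prop :=
  forall e : R, 0 < e -> \forall y \near within D (nbhs x),
    `|f y - f x - dotp v (y - x)| <= e * l2norm (y - x).

Definition is_jacobian_on m n (D : set 'cV[R]_n) (f : 'cV[R]_n -> 'cV[R]_m)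
    (x : 'cV[R]_n) (J : 'M[R]_(m, n)) : Prop :=
  forall e : R, 0 < e -> \forall y \near within D (nbhs x),
    l2norm (f y - f x - J *m (y - x)) <= e * l2norm (y - x).

Definition grad_on n (D : set 'cV[R]_n) (f : 'cV[R]_n -> R) (x : 'cV[R]_n) :
    'cV[R]_n :=
  xget 0 [set v | is_grad_on D f x v].

Definition lipschitz_for n (V : zmodType) (N : V -> R) (D : set 'cV[R]_n)
    (L : R) (f : 'cV[R]_n -> V) : Prop :=
  forall x y, D x -> D y -> N (f x - f y) <= L * l2norm (x - y).

Definition strongly_convex_on n (D : set 'cV[R]_n) (mu : R)
    (f : 'cV[R]_n -> R) : Prop :=
  forall (x y : 'cV[R]_n) (s : R), D x -> D y -> 0 <= s <= 1 ->
    f (s *: x + (1 - s) *: y) <=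
      s * f x + (1 - s) * f y - mu / 2 * s * (1 - s) * l2norm (x - y) ^+ 2.

Definition is_argmin n (D : set 'cV[R]_n) (f : 'cV[R]_n -> R)
    (x : 'cV[R]_n) : Prop :=
  D x /\ forall y, D y -> f x <= f y.

End Euclidean.

Section Bilevel.
Variables (R : realType) (d1 d2 : nat).
Implicit Types (X : set 'cV[R]_d1) (lam : 'cV[R]_d1) (beta : 'cV[R]_d2).

Definition joint_domain X : set 'cV[R]_(d1 + d2) :=
  [set z | X (usubmx z)].

Definition outer_regular X (lf0 lf1 : R) (f : 'cV[R]_(d1 + d2) -> R)
    (df : 'cV[R]_(d1 + d2) -> 'cV[R]_(d1 + d2)) : Prop :=
  let D := joint_domain X in
  [/\ forall z, D z -> is_grad_on D f z (df z),
      lipschitz_for Num.norm D lf0 f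
    & lipschitz_for (@l2norm R _) D lf1 df].

(* [dglb] and [dgbb] are the second derivative blocks of sizes d1 x d2 and
   d2 x d2; together they form the Jacobian of the beta-part of [dg]. *)
Definition inner_regular X (lg1 lg2 : R) (g : 'cV[R]_(d1 + d2) -> R)
    (dg : 'cV[R]_(d1 + d2) -> 'cV[R]_(d1 + d2))
    (dglb : 'cV[R]_(d1 + d2) -> 'M[R]_(d1, d2))
    (dgbb : 'cV[R]_(d1 + d2) -> 'M[R]_d2) : Prop :=
  let D := joint_domain X in
  [/\ forall z, D z -> is_grad_on D g z (dg z),
      forall z, D z ->
        is_jacobian_on D (fun y => dsubmx (dg y)) z
          (row_mx (dglb z)^T (dgbb z)),
      lipschitz_for (@l2norm R _) D lg1 dg,
      lipschitz_for (@spectral_norm R _ _) D lg2 dglb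
    & lipschitz_for (@spectral_norm R _ _) D lg2 dgbb].

Definition beta_hat (g : 'cV[R]_(d1 + d2) -> R) lam : 'cV[R]_d2 :=
  xget 0 [set b | is_argmin setT (fun b' => g (col_mx lam b')) b].

Definition outer_obj (f g : 'cV[R]_(d1 + d2) -> R) lam : R :=
  f (col_mx lam (beta_hat g lam)).

Definition bregman (phi : 'cV[R]_d1 -> R) (dphi : 'cV[R]_d1 -> 'cV[R]_d1)
    (l2 l1 : 'cV[R]_d1) : R :=
  phi l2 - phi l1 - dotp (dphi l1) (l2 - l1).

Definition prox_obj (h phi : 'cV[R]_d1 -> R) (dphi : 'cV[R]_d1 -> 'cV[R]_d1)
    (alpha : R) (u q l : 'cV[R]_d1) : R :=
  dotp q l + h l + alpha^-1 * bregman phi dphi l u.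

(* The minimizer is unique when it exists, phi being strongly convex.  It may
   only fail to exist if h is not lower semicontinuous; the value is then u. *)
Definition bregman_step X (h phi : 'cV[R]_d1 -> R)
    (dphi : 'cV[R]_d1 -> 'cV[R]_d1) (alpha : R) (u q : 'cV[R]_d1) :
    'cV[R]_d1 :=
  xget u [set l | is_argmin X (prox_obj h phi dphi alpha u q) l].

Definition gen_proj X (h phi : 'cV[R]_d1 -> R)
    (dphi : 'cV[R]_d1 -> 'cV[R]_d1) (alpha : R) (u q : 'cV[R]_d1) :
    'cV[R]_d1 :=
  alpha^-1 *: (u - bregman_step X h phi dphi alpha u q).

(* Terms of index t - i <= 0 are zero by convention; the condition i < t also
   rules out the truncation of the subtraction on nat. *)
Definition window_avg n (w : nat) (a : nat -> 'cV[R]_n) (t : nat) : 'cV[R]_n :=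
  (w%:R)^-1 *: \sum_(i < w | (i < t)%N) a (t - i)%N.

Definition inner_iter (dg : 'cV[R]_(d1 + d2) -> 'cV[R]_(d1 + d2)) (eta : R)
    lam (beta0 : 'cV[R]_d2) (k : nat) : 'cV[R]_d2 :=
  iter k (fun om => om - eta *: dsubmx (dg (col_mx lam om))) beta0.

Definition hypergrad (df dg : 'cV[R]_(d1 + d2) -> 'cV[R]_(d1 + d2))
    (dglb : 'cV[R]_(d1 + d2) -> 'M[R]_(d1, d2))
    (dgbb : 'cV[R]_(d1 + d2) -> 'M[R]_d2) (eta : R) (K : nat)
    lam (beta0 : 'cV[R]_d2) : 'cV[R]_d1 :=
  let z k := col_mx lam (inner_iter dg eta lam beta0 k) in
  usubmx (df (z K)) -
  eta *: \sum_(0 <= k < K)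
    dglb (z k) *m
    (\big[mulmx/1%:M]_(k.+1 <= j < K) (1%:M - eta *: dgbb (z j))) *m
    dsubmx (df (z K)).

(* [lam t], [beta t] are the iterates for 1 <= t <= T + 1; indices outside this
   range are unconstrained. *)
Definition obbo X (h : 'cV[R]_d1 -> R) (phi : nat -> 'cV[R]_d1 -> R)
    (dphi : nat -> 'cV[R]_d1 -> 'cV[R]_d1)
    (df dg : nat -> 'cV[R]_(d1 + d2) -> 'cV[R]_(d1 + d2))
    (dglb : nat -> 'cV[R]_(d1 + d2) -> 'M[R]_(d1, d2))
    (dgbb : nat -> 'cV[R]_(d1 + d2) -> 'M[R]_d2)
    (eta alpha : R) (T w K : nat)
    (lam : nat -> 'cV[R]_d1) (beta : nat -> 'cV[R]_d2) : Prop :=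
  X (lam 1) /\
  forall t, (1 <= t <= T)%N ->
    beta t.+1 = inner_iter (dg t) eta (lam t) (beta t) K /\
    is_argmin X
      (prox_obj h (phi t) (dphi t) alpha (lam t)
        (window_avg w (fun s =>
           hypergrad (df s) (dg s) (dglb s) (dgbb s) eta K (lam s) (beta s)) t))
      (lam t.+1).

(* The gradient of F_t is only determined up to directions orthogonal to X - X,
   which do not affect [gen_proj]. *)
Definition BLR X (h : 'cV[R]_d1 -> R) (phi : nat -> 'cV[R]_d1 -> R)
    (dphi : nat -> 'cV[R]_d1 -> 'cV[R]_d1)
    (f g : nat -> 'cV[R]_(d1 + d2) -> R) (alpha : R) (T w : nat)
    (lam : nat -> 'cV[R]_d1) : R :=
  \sum_(1 <= t < T.+1)
    l2norm (gen_proj X h (phi t) (dphi t) alpha (lam t)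
      (window_avg w
         (fun s => grad_on X (outer_obj (f s) (g s)) (lam s)) t)) ^+ 2.

Definition V1 X (f g : nat -> 'cV[R]_(d1 + d2) -> R) (T : nat) : R :=
  \sum_(1 <= t < T.+1)
    sup [set `|outer_obj (f t.+1) (g t.+1) l - outer_obj (f t) (g t) l|
        | l in X].

Definition H2 X (g : nat -> 'cV[R]_(d1 + d2) -> R) (T : nat) : R :=
  \sum_(2 <= t < T.+1)
    sup [set l2norm (beta_hat (g t.-1) l - beta_hat (g t) l) ^+ 2 | l in X].

End Bilevel.

Section Constants.
Variables (R : realType) (lf0 lf1 lg1 lg2 mu eta : R) (K : nat).

Definition kappa : R := lg1 / mu.

Definition Mf : R :=
  lf1 + lf1 * kappa + lf0 * lg2 / mu * (1 + kappa).

Definition lF1 : R :=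
  lf1 * (1 + kappa) + lf0 * lg2 / mu * (1 + kappa) + Mf * kappa.

Definition nu : R := (1 - eta * mu / 2) * (1 - eta * mu) ^+ K.-1.

Definition Cmu : R := 1 + 2 / (eta * mu).

Definition L1 : R := kappa * (lg1 + mu).

Definition L2 : R := 2 * lf0 * lg2 / mu * (1 + kappa).

Definition Lbeta : R :=
  L1 ^+ 2 * (1 - eta * mu) ^+ K + L2 ^+ 2 * (1 - eta * mu) ^+ K.-1.

End Constants.

(* Main.v *)
Require Import Defs.
From mathcomp Require Import ring lra zify.
Import Order.TTheory GRing.Theory Num.Theory.
Import numFieldNormedType.Exports.
Local Open Scope classical_set_scope.
Local Open Scope ring_scope.

(** The prox inequality bounds the squared step by the pairing of the windowed
    hypergradient with the displacement plus a telescoping decrease of h.  Every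
    gradient enters w consecutive window averages with weight 1/w, so exchanging
    the sums pairs it with a telescoping displacement, which is at most the
    diameter of X: the total is O(T/w), with no smoothness of F_t and no V_{1,T}
    needed.  Convexity bounds h below on X, and w = O(T) absorbs constants into
    T/w.

    The remaining error is the distance between the hypergradient estimate and
    the gradient of F_t, which is of the order of (1 - eta mu)^K times the
    tracking error of the inner iterates, up to a term independent of it.  By the
    choice of K its square carries a factor 1/T, while the squared tracking
    errors sum to O(1 + T kappa^2 + kappa^2 H_{2,T}) because X is bounded.  The
    first step size bound controls kappa and the coefficients of the error
    independently of l_{g,1} and mu_g.

    Since X may have empty interior, gradients and mixed derivatives are only
    controlled against differences of points of X. *)

(** The contraction factor of the inner iteration has to be exactly [1 - eta * mu], the base in
    which K is calibrated. For step sizes up to 1/l_{g,1} it is the operator norm of I - eta H,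
    which calls for a symmetric Hessian H. As [dgbb] is only given as a Jacobian of the gradient,
    symmetry is derived by Young's second-difference argument.

    [beta_hat] is never differentiated, only shown to be [kappa]-Lipschitz. The gradient of F_t is
    found by adding the vanishing increment of the optimality condition, tested against the adjoint
    vector c = H^-1 (grad_beta f): this cancels the unknown increment of [beta_hat] to first order.

    The hypergradient error contains K q^(K-1) with q = 1 - eta mu, and K grows like log T. In the
    square of K eta mu q^(K-1), half of the exponent is spent on the polynomial factor, which leaves
    4 q^(K-1): no logarithm survives. The compensating 1/mu goes into l_{f,0} l_{g,2} (1 + kappa) /
    mu, a summand of l_{F,1}. *)

Set Implicit Arguments.
Unset Strict Implicit.
Unset Printing Implicit Defensive.

(** * Euclidean norm *)

Section EuclideanTheory.
Variable R : realType.
Implicit Types (n m : nat) (a e : R).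

Lemma dotpC n (u v : 'cV[R]_n) : dotp u v = dotp v u.
Proof. by apply: eq_bigr => i _; rewrite mulrC. Qed.

Lemma dotpE n (u v : 'cV[R]_n) : dotp u v = (u^T *m v) 0 0.
Proof. by rewrite mxE; apply: eq_bigr => i _; rewrite mxE. Qed.

Lemma dotpDr n (u v w : 'cV[R]_n) : dotp u (v + w) = dotp u v + dotp u w.
Proof. by rewrite !dotpE mulmxDr mxE. Qed.

Lemma dotpNr n (u v : 'cV[R]_n) : dotp u (- v) = - dotp u v.
Proof. by rewrite !dotpE mulmxN mxE. Qed.

Lemma dotpBr n (u v w : 'cV[R]_n) : dotp u (v - w) = dotp u v - dotp u w.
Proof. by rewrite dotpDr dotpNr. Qed.

Lemma dotpZr n a (u v : 'cV[R]_n) : dotp u (a *: v) = a * dotp u v.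
Proof. by rewrite !dotpE -scalemxAr mxE. Qed.

Lemma dotp0r n (u : 'cV[R]_n) : dotp u 0 = 0.
Proof. by rewrite dotpE mulmx0 mxE. Qed.

Lemma dotpDl n (u v w : 'cV[R]_n) : dotp (v + w) u = dotp v u + dotp w u.
Proof. by rewrite dotpC dotpDr !(dotpC u). Qed.

Lemma dotpNl n (u v : 'cV[R]_n) : dotp (- v) u = - dotp v u.
Proof. by rewrite dotpC dotpNr dotpC. Qed.

Lemma dotpBl n (u v w : 'cV[R]_n) : dotp (v - w) u = dotp v u - dotp w u.
Proof. by rewrite dotpDl dotpNl. Qed.

Lemma dotpZl n a (u v : 'cV[R]_n) : dotp (a *: v) u = a * dotp v u.
Proof. by rewrite dotpC dotpZr dotpC. Qed.

Lemma dotp0l n (u : 'cV[R]_n) : dotp 0 u = 0.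
Proof. by rewrite dotpC dotp0r. Qed.

Lemma dotp_suml n I (r : seq I) (P : pred I) (F : I -> 'cV[R]_n) u :
  dotp (\sum_(i <- r | P i) F i) u = \sum_(i <- r | P i) dotp (F i) u.
Proof.
apply: (big_morph (fun v => dotp v u)); last exact: dotp0l.
by move=> x y; rewrite dotpDl.
Qed.

Lemma dotp_sumr n I (r : seq I) (P : pred I) (F : I -> 'cV[R]_n) u :
  dotp u (\sum_(i <- r | P i) F i) = \sum_(i <- r | P i) dotp u (F i).
Proof. by rewrite dotpC dotp_suml; apply: eq_bigr => i _; rewrite dotpC. Qed.

Lemma dotp_mulmx m n (A : 'M[R]_(m, n)) u v :
  dotp (A *m u) v = dotp u (A^T *m v).
Proof. by rewrite !dotpE trmx_mul mulmxA. Qed.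

Lemma dotp_col_mx m n (u u' : 'cV[R]_m) (v v' : 'cV[R]_n) :
  dotp (col_mx u v) (col_mx u' v') = dotp u u' + dotp v v'.
Proof. by rewrite !dotpE tr_col_mx mul_row_col mxE. Qed.

Lemma dotp_ge0 n (u : 'cV[R]_n) : 0 <= dotp u u.
Proof. by apply: sumr_ge0 => i _; rewrite -expr2 sqr_ge0. Qed.

Lemma l2norm_ge0 n (u : 'cV[R]_n) : 0 <= l2norm u.
Proof. exact: sqrtr_ge0. Qed.

Lemma l2norm_sqr n (u : 'cV[R]_n) : l2norm u ^+ 2 = dotp u u.
Proof. by rewrite sqr_sqrtr ?dotp_ge0. Qed.

Lemma l2normN n (u : 'cV[R]_n) : l2norm (- u) = l2norm u.
Proof. by rewrite /l2norm dotpNl dotpNr opprK. Qed.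

Lemma l2normBC n (u v : 'cV[R]_n) : l2norm (u - v) = l2norm (v - u).
Proof. by rewrite -l2normN opprB. Qed.

Lemma l2norm0 n : l2norm (0 : 'cV[R]_n) = 0.
Proof. by rewrite /l2norm dotp0l sqrtr0. Qed.

Lemma l2normZ n a (u : 'cV[R]_n) : l2norm (a *: u) = `|a| * l2norm u.
Proof. by rewrite /l2norm dotpZl dotpZr mulrA -expr2 sqrtrM ?sqr_ge0// sqrtr_sqr. Qed.

Lemma l2norm_eq0 n (u : 'cV[R]_n) : l2norm u = 0 -> u = 0.
Proof.
move=> /(congr1 (fun a => a ^+ 2)); rewrite l2norm_sqr expr0n /= => u0.
apply/colP => i; rewrite mxE; apply/eqP; rewrite -sqrf_eq0 expr2.
by move/psumr_eq0P : u0 => ->// j _; rewrite -expr2 sqr_ge0.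
Qed.

Lemma quadratic_ge0_discr a b c :
  (forall t, 0 <= a + 2 * b * t + c * t ^+ 2) -> b ^+ 2 <= a * c.
Proof.
move=> P.
have a0 : 0 <= a by have := P 0; nra.
have [c0|c0] := eqVneq c 0.
  have [->|b0] := eqVneq b 0; first by rewrite c0; lra.
  (* At this point the affine function takes the value -1. *)
  have := P (- (a + 1) / (2 * b)); rewrite c0 mul0r addr0.
  have -> : 2 * b * (- (a + 1) / (2 * b)) = - (a + 1) by field.
  lra.
have {}c0 : 0 < c.
  rewrite lt_neqAle eq_sym c0 /= leNgt; apply/negP => cn.
  have := P ((a + 2 * `|b| + 1) / (- c)  + 1).
  set t := _ / _; have tE : c * t = - (a + 2 * `|b| + 1) by rewrite /t; field; lra.
  have t0 : 0 <= t.
    by rewrite divr_ge0//; [have := normr_ge0 b; lra | lra].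
  have := ler_norm b; nra.
have := P (- b / c).
have -> : a + 2 * b * (- b / c) + c * (- b / c) ^+ 2 = (a * c - b ^+ 2) / c.
  by field; rewrite gt_eqF.
by rewrite pmulr_lge0 ?invr_gt0// subr_ge0.
Qed.

(** Discriminant of the quadratic t -> <A (u + t v), u + t v>. The identity gives the usual
    Cauchy-Schwarz inequality; A = I - eta H gives the contraction factor of gradient descent. *)
Lemma psd_CauchySchwarz n (A : 'M[R]_n) (u v : 'cV[R]_n) :
  A^T = A -> (forall z, 0 <= dotp (A *m z) z) ->
  dotp (A *m u) v ^+ 2 <= dotp (A *m u) u * dotp (A *m v) v.
Proof.
move=> symA psdA; apply: quadratic_ge0_discr => t.
have := psdA (u + t *: v).
rewrite mulmxDr -scalemxAr !(dotpDl, dotpDr, dotpZl, dotpZr).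
rewrite (dotp_mulmx A v u) symA (dotpC v).
by congr (_ <= _); ring.
Qed.

Lemma normr_dotp_le n (u v : 'cV[R]_n) : `|dotp u v| <= l2norm u * l2norm v.
Proof.
rewrite -(@ler_pXn2r _ 2) ?nnegrE ?mulr_ge0 ?l2norm_ge0//.
rewrite exprMn !l2norm_sqr real_normK ?num_real//.
have := @psd_CauchySchwarz n 1%:M u v (trmx1 _ _); rewrite !mul1mx.
by apply => z; rewrite mul1mx dotp_ge0.
Qed.

Lemma dotp_le n (u v : 'cV[R]_n) : dotp u v <= l2norm u * l2norm v.
Proof. exact: le_trans (ler_norm _) (normr_dotp_le u v). Qed.

Lemma ler_l2normD n (u v : 'cV[R]_n) : l2norm (u + v) <= l2norm u + l2norm v.
Proof.
rewrite -(@ler_pXn2r _ 2) ?nnegrE ?addr_ge0 ?l2norm_ge0//.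
rewrite sqrrD !l2norm_sqr !(dotpDl, dotpDr) (dotpC v).
have := dotp_le u v; lra.
Qed.

Lemma ler_l2normB n (u v : 'cV[R]_n) : l2norm (u - v) <= l2norm u + l2norm v.
Proof. by rewrite -(l2normN v) ler_l2normD. Qed.

Lemma ler_l2norm_sum n I (r : seq I) (P : pred I) (F : I -> 'cV[R]_n) :
  l2norm (\sum_(i <- r | P i) F i) <= \sum_(i <- r | P i) l2norm (F i).
Proof.
elim/big_ind2 : _ => // [|a u b v ua vb]; first by rewrite l2norm0.
exact: le_trans (ler_l2normD _ _) (lerD ua vb).
Qed.

(** Serves to bound a vector that is only known through pairings, by testing it against itself. *)
Lemma l2norm_le_dotp n (u : 'cV[R]_n) a : 0 <= a ->
  dotp u u <= a * l2norm u -> l2norm u <= a.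
Proof.
move=> a0; rewrite -l2norm_sqr expr2.
have [->//|u0] := eqVneq (l2norm u) 0.
by rewrite ler_pM2r // lt_neqAle eq_sym u0 l2norm_ge0.
Qed.

Lemma l2norm_col_mx_l m n (u : 'cV[R]_m) :
  l2norm (col_mx u (0 : 'cV[R]_n)) = l2norm u.
Proof. by rewrite /l2norm dotp_col_mx dotp0l addr0. Qed.

Lemma l2norm_col_mx_r m n (v : 'cV[R]_n) :
  l2norm (col_mx (0 : 'cV[R]_m) v) = l2norm v.
Proof. by rewrite /l2norm dotp_col_mx dotp0l add0r. Qed.

Lemma l2norm_col_mx_le m n (u : 'cV[R]_m) (v : 'cV[R]_n) :
  l2norm (col_mx u v) <= l2norm u + l2norm v.
Proof.
have -> : col_mx u v = col_mx u 0 + col_mx 0 v by rewrite add_col_mx addr0 add0r.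
by rewrite (le_trans (ler_l2normD _ _))// l2norm_col_mx_l l2norm_col_mx_r.
Qed.

Lemma l2norm_usubmx m n (z : 'cV[R]_(m + n)) : l2norm (usubmx z) <= l2norm z.
Proof.
rewrite -[in leRHS](vsubmxK z) /l2norm dotp_col_mx ler_wsqrtr//.
by rewrite lerDl dotp_ge0.
Qed.

Lemma l2norm_dsubmx m n (z : 'cV[R]_(m + n)) : l2norm (dsubmx z) <= l2norm z.
Proof.
rewrite -[in leRHS](vsubmxK z) /l2norm dotp_col_mx ler_wsqrtr//.
by rewrite lerDr dotp_ge0.
Qed.

Lemma normr_coord_le n (u : 'cV[R]_n) i : `|u i 0| <= l2norm u.
Proof.
rewrite -(@ler_pXn2r _ 2) ?nnegrE ?l2norm_ge0// l2norm_sqr.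
rewrite real_normK ?num_real// /dotp (bigD1 i)//= -expr2 lerDl.
by apply: sumr_ge0 => j _; rewrite -expr2 sqr_ge0.
Qed.

Lemma l2norm_le_sum n (u : 'cV[R]_n) : l2norm u <= \sum_i `|u i 0|.
Proof.
rewrite -(@ler_pXn2r _ 2) ?nnegrE ?l2norm_ge0 ?sumr_ge0// l2norm_sqr.
rewrite expr2 big_distrl /=; apply: ler_sum => i _.
rewrite -expr2 -real_normK ?num_real// expr2.
by rewrite ler_wpM2l// (bigD1 i)//= lerDl sumr_ge0.
Qed.

Lemma spectral_norm_has_ubound m n (A : 'M[R]_(m, n)) :
  has_ubound [set l2norm (A *m x) | x in [set x : 'cV[R]_n | l2norm x <= 1]].
Proof.
exists (\sum_i \sum_j `|A i j|) => _ [x /= x1 <-].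
apply: (le_trans (l2norm_le_sum _)); apply: ler_sum => i _.
rewrite mxE (le_trans (ler_norm_sum _ _ _))//; apply: ler_sum => j _.
by rewrite normrM ler_piMr// (le_trans (normr_coord_le _ _)).
Qed.

Lemma l2norm_mulmx_le m n (A : 'M[R]_(m, n)) (u : 'cV[R]_n) :
  l2norm (A *m u) <= spectral_norm A * l2norm u.
Proof.
have [/l2norm_eq0 ->|u0] := eqVneq (l2norm u) 0.
  by rewrite mulmx0 !l2norm0 mulr0.
have {}u0 : 0 < l2norm u by rewrite lt_neqAle eq_sym u0 l2norm_ge0.
rewrite -ler_pdivrMr//; apply: ub_le_sup; first exact: spectral_norm_has_ubound.
exists ((l2norm u)^-1 *: u) => /=.
  by rewrite l2normZ ger0_norm ?invr_ge0 ?l2norm_ge0// mulVf// gt_eqF.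
by rewrite -scalemxAr l2normZ ger0_norm ?invr_ge0 ?l2norm_ge0// mulrC.
Qed.

(* The sup norm and the l2 norm induce the same neighbourhoods. *)
Lemma within_l2normP n (D : set 'cV[R]_n) (x : 'cV[R]_n) (P : 'cV[R]_n -> Prop) :
  (\forall y \near within D (nbhs x), P y) <->
  exists2 d : R, 0 < d & forall y, D y -> l2norm (y - x) < d -> P y.
Proof.
rewrite /prop_near1 /within /=; split.
  move=> /nbhs_ballP[d /= d0 dP]; exists d => // y Dy yx; apply: dP => //.
  split => // i j; rewrite (ord1 j) /ball /= distrC.
  by rewrite (le_lt_trans _ yx)//; have := normr_coord_le (y - x) i; rewrite !mxE.
move=> [d d0 dP]; apply/nbhs_ballP.
(* The l2 norm is at most the sum of n coordinates; dividing by n + 1 instead of n keeps the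
   inequality strict and covers n = 0. *)
exists (d / (n.+1)%:R) => /=; first by rewrite divr_gt0.
move=> y [_ yx] Dy; apply: dP => //.
apply: le_lt_trans (l2norm_le_sum _) _.
have lt_d : \sum_(i < n) d / n.+1%:R < d.
  rewrite sumr_const card_ord -mulrnAr -[ltRHS]mulr1 ltr_pM2l//.
  by rewrite -[_ *+ n]mulr_natl ltr_pdivrMr// mul1r ltr_nat.
apply: le_lt_trans lt_d; apply: ler_sum => i _; apply: ltW.
by have := yx i 0; rewrite /ball /= distrC !mxE.
Qed.

End EuclideanTheory.

(** * Differentiation relative to a set and strong convexity *)

Section MeanValue.
Variable R : realType.
Implicit Types (n m : nat) (a c e s t : R).

Lemma is_grad_onP n (D : set 'cV[R]_n) f x v :
  is_grad_on D f x v <->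
  forall e, 0 < e -> exists2 d, 0 < d & forall y, D y -> l2norm (y - x) < d ->
    `|f y - f x - dotp v (y - x)| <= e * l2norm (y - x).
Proof. by split=> H e /H /within_l2normP. Qed.

Lemma grad_on_line_is_derive n (f : 'cV[R]_n -> R) (df : 'cV[R]_n -> 'cV[R]_n)
    (x u : 'cV[R]_n) (s : R^o) :
  (forall y, is_grad_on setT f y (df y)) ->
  is_derive s 1 (fun t : R^o => f (x + t *: u) : R^o) (dotp (df (x + s *: u)) u).
Proof.
move=> /(_ (x + s *: u))/is_grad_onP gradf.
set phi := fun t : R^o => _.
have cvg_phi : h^-1 *: (phi (h *: 1 + s) - phi s) @[h --> 0^']
    --> (dotp (df (x + s *: u)) u : R^o).
  apply/cvgrPdist_le => e e0.
  have N0 := l2norm_ge0 u.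
  (* The quotient below has error at most this tolerance times |u|; the + 1 allows u = 0. *)
  have [|d d0 dP] := gradf (e / (l2norm u + 1)); first by rewrite divr_gt0//; lra.
  near=> h.
  have h0 : h != 0 by near: h; exact: nbhs_dnbhs_neq.
  have hd : `|h| < d / (l2norm u + 1).
    near: h; apply: dnbhs0_lt; rewrite divr_gt0//; lra.
  have yE : x + (h *: 1 + s) *: u - (x + s *: u) = h *: u.
    by rewrite opprD addrACA subrr add0r scalerDl addrK; congr (_ *: _); exact: mulr1.
  have := dP (x + (h *: 1 + s) *: u) I; rewrite yE l2normZ dotpZr => /(_ _).
  have hd' : `|h| * l2norm u < d.
    by move: hd; rewrite ltr_pdivlMr; have := normr_ge0 h; nra.
  move=> /(_ hd') hP.
  rewrite -(@ler_pM2r _ `|h|) ?normr_gt0// -normrM.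
  have le_e : e / (l2norm u + 1) * (`|h| * l2norm u) <= e * `|h|.
    have -> : e / (l2norm u + 1) * (`|h| * l2norm u) =
        e * `|h| * (l2norm u / (l2norm u + 1)) by ring.
    by rewrite ler_piMr ?mulr_ge0 ?(ltW e0)// ler_pdivrMr; lra.
  apply: le_trans le_e; apply: le_trans hP; rewrite -normrN le_eqVlt.
  apply/orP; left; apply/eqP; congr (`|_|); rewrite /phi /GRing.scale /=; field.
  exact: h0.
apply: DeriveDef; first by apply/cvg_ex; exists (dotp (df (x + s *: u)) u).
exact: cvg_lim.
Unshelve. all: by end_near. Qed.

Lemma mean_value_dist_le (phi dphi : R^o -> R^o) (m c : R) :
  (forall s : R^o, is_derive s 1 phi (dphi s)) ->
  (forall s, 0 <= s <= 1 -> `|dphi s - m| <= c) ->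
  `|phi 1 - phi 0 - m| <= c.
Proof.
move=> dphiE dphi_le.
have [|t t01 ->] := @MVT R phi dphi 0 1 ltr01 (fun s _ => dphiE s).
  apply: continuous_subspaceT => s.
  apply: (@differentiable_continuous R R^o R^o).
  exact/derivable1_diffP/ex_derive.
rewrite subr0 mulr1; apply: dphi_le.
by move: t01; rewrite in_itv /= => /andP[/ltW-> /ltW->].
Qed.

Lemma is_jacobian_onP n m (D : set 'cV[R]_n) (f : 'cV[R]_n -> 'cV[R]_m) x J :
  is_jacobian_on D f x J <->
  forall e, 0 < e -> exists2 d, 0 < d & forall y, D y -> l2norm (y - x) < d ->
    l2norm (f y - f x - J *m (y - x)) <= e * l2norm (y - x).
Proof. by split=> H e /H /within_l2normP. Qed.

(** Dividing by s and letting s tend to 0. It stands in for every one-sided limit along a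
    segment. *)
Lemma le_of_small_quadratic a b c : 0 <= c ->
  (forall s, 0 < s <= 1 -> s * a <= s * (b + c * s)) -> a <= b.
Proof.
move=> c0 P; rewrite leNgt; apply/negP => ab.
(* Then s <= 1/2 and c s <= (a - b) / 2, against a - b <= c s. *)
pose s := (a - b) / (2 * (c + (a - b))).
have s0 : 0 < s by rewrite divr_gt0; lra.
have sE : s * (2 * (c + (a - b))) = a - b by rewrite /s; field; lra.
have s1 : s <= 1 by nra.
have := P s; rewrite s0 s1 => /(_ isT); rewrite ler_pM2l//; nra.
Qed.

Lemma le_of_small_linear a b c : 0 <= c ->
  (forall e, 0 < e <= 1 -> a <= b + c * e) -> a <= b.
Proof.
move=> c0 P; apply: (le_of_small_quadratic c0) => s /[dup] /andP[s0 _] /P.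
by rewrite ler_pM2l.
Qed.

(** A gradient relative to D can only be tested along directions that stay in D; any bound on
    increments of f that is first order in s passes to the pairing with such a direction. *)
Lemma grad_on_dir_le n (D : set 'cV[R]_n) f x v u b c : 0 <= c ->
  is_grad_on D f x v ->
  (forall s, 0 < s <= 1 -> D (x + s *: u)) ->
  (forall s, 0 < s <= 1 -> f (x + s *: u) - f x <= s * (b + c * s)) ->
  dotp v u <= b.
Proof.
move=> c0 /is_grad_onP vP Du fP.
apply: (@le_of_small_linear _ _ (l2norm u + c)) => [|e /andP[e0 e1]].
  by rewrite addr_ge0// l2norm_ge0.
have [d d0 dP] := vP e e0.
(* Both s <= e, so that c s <= c e, and s |u| < d, so that the first-order expansion applies. *)
pose s := Num.min e (d / (2 * (l2norm u + 1))).
have u0 := l2norm_ge0 u.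
have s0 : 0 < s by rewrite lt_min e0 divr_gt0//; lra.
have se : s <= e by rewrite ge_min lexx.
have sd : s * l2norm u < d.
  have : s <= d / (2 * (l2norm u + 1)) by rewrite ge_min lexx orbT.
  rewrite ler_pdivlMr; nra.
have s01 : 0 < s <= 1 by rewrite s0; lra.
have := dP _ (Du s s01); rewrite addrAC subrr add0r l2normZ gtr0_norm// => /(_ sd).
rewrite dotpZr => /ler_normlP[] + _; have := fP s s01 => h1 h2.
have : s * dotp v u <= s * (b + c * s + e * l2norm u) by lra.
rewrite ler_pM2l//; nra.
Qed.

Lemma grad_on_dir_ge n (D : set 'cV[R]_n) f x v u b c : 0 <= c ->
  is_grad_on D f x v ->
  (forall s, 0 < s <= 1 -> D (x + s *: u)) ->
  (forall s, 0 < s <= 1 -> s * (b - c * s) <= f (x + s *: u) - f x) ->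
  b <= dotp v u.
Proof.
move=> c0 /is_grad_onP vP Du fP.
rewrite -lerN2 -dotpNl.
apply: (@grad_on_dir_le n D (fun y => - f y) x (- v) u (- b) c) => //.
  apply/is_grad_onP => e /vP[d d0 dP]; exists d => // y Dy yx.
  by rewrite -normrN dotpNl !opprD !opprK dP.
by move=> s /fP; lra.
Qed.

(** Reduces statements about Jacobians to the scalar lemmas on gradients. *)
Lemma jacobian_dotp n m (D : set 'cV[R]_n) (f : 'cV[R]_n -> 'cV[R]_m) x J z :
  is_jacobian_on D f x J ->
  is_grad_on D (fun y => dotp z (f y)) x (J^T *m z).
Proof.
move=> /is_jacobian_onP JP; apply/is_grad_onP => e e0.
have [|d d0 dP] := JP (e / (l2norm z + 1)).
  by rewrite divr_gt0// ltr_wpDl// l2norm_ge0.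
exists d => // y Dy yx.
rewrite dotp_mulmx trmxK -!dotpBr.
apply: le_trans (normr_dotp_le _ _) _.
apply: le_trans (ler_wpM2l (l2norm_ge0 _) (dP y Dy yx)) _.
rewrite mulrA ler_wpM2r ?l2norm_ge0// mulrCA ler_piMr ?(ltW e0)//.
by rewrite ler_pdivrMr ?mul1r ?lerDl ?ltr_wpDl ?l2norm_ge0.
Qed.

End MeanValue.

Section StrongConvexity.
Variable R : realType.
Implicit Types (n m : nat) (a c e s t mu : R).

Lemma strongly_convex_growth n (D : set 'cV[R]_n) mu f x y :
  (forall s, 0 < s <= 1 -> D (s *: y + (1 - s) *: x)) -> 0 <= mu ->
  strongly_convex_on D mu f -> is_argmin D f x -> D y ->
  f x + mu / 2 * l2norm (y - x) ^+ 2 <= f y.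
Proof.
move=> Dseg mu0 fP [Dx xmin] Dy.
rewrite -lerBrDl; set N := l2norm _ ^+ 2.
have N0 : 0 <= N by exact: sqr_ge0.
apply: (@le_of_small_quadratic _ _ _ (mu / 2 * N)); first by nra.
move=> s /[dup] s01 /andP[s0 s1].
have := xmin _ (Dseg s s01).
have := fP y x s Dy Dx; rewrite s1 (ltW s0) => /(_ isT); rewrite -/N; lra.
Qed.

Lemma strongly_convex_grad n (D : set 'cV[R]_n) mu f x y v :
  (forall s, 0 < s <= 1 -> D (s *: y + (1 - s) *: x)) -> 0 <= mu ->
  strongly_convex_on D mu f -> D x -> D y -> is_grad_on D f x v ->
  f x + dotp v (y - x) + mu / 2 * l2norm (y - x) ^+ 2 <= f y.
Proof.
move=> Dseg mu0 fP Dx Dy vP.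
rewrite -lerBrDr addrC -lerBrDr; set N := l2norm _ ^+ 2.
have N0 : 0 <= N by exact: sqr_ge0.
have segE s : x + s *: (y - x) = s *: y + (1 - s) *: x.
  by rewrite scalerBr scalerBl scale1r addrCA.
apply: (@grad_on_dir_le _ _ D f _ _ _ _ (mu / 2 * N)) vP _ _; first by nra.
  by move=> s s01; rewrite segE; exact: Dseg.
move=> s /andP[s0 s1]; rewrite segE.
have := fP y x s Dy Dx; rewrite s1 (ltW s0) => /(_ isT); rewrite -/N; lra.
Qed.

End StrongConvexity.

(** * Gradient descent on a smooth strongly convex function *)

Section FixedPoint.
Variable R : realType.

Lemma l2norm_iter_contraction n (F : 'cV[R]_n -> 'cV[R]_n) q a b k : 0 <= q ->
  (forall a b, l2norm (F a - F b) <= q * l2norm (a - b)) ->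
  l2norm (iter k F a - iter k F b) <= q ^+ k * l2norm (a - b).
Proof.
move=> q0 Fq; elim: k => [|k IH]; first by rewrite expr0 mul1r.
by rewrite !iterS (le_trans (Fq _ _))// exprS -mulrA ler_wpM2l.
Qed.

(** Banach's theorem for the l2 norm. The iterates from 0 have increments below a geometric series,
    so every coordinate converges; for the limit l, |F l - l| <= 2 n e for all small e. *)
Lemma l2norm_contraction_fixpoint n (F : 'cV[R]_n -> 'cV[R]_n) q : 0 <= q < 1 ->
  (forall a b, l2norm (F a - F b) <= q * l2norm (a - b)) ->
  exists b, F b = b.
Proof.
move=> /andP[q0 q1] Fq; pose om k := iter k F 0.
pose d := l2norm (F 0).
have om_step k : l2norm (om k.+1 - om k) <= d * q ^+ k.
  rewrite {1}/om iterSr mulrC; have := l2norm_iter_contraction (F 0) 0 k q0 Fq.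
  by rewrite subr0.
have cvg_om i : cvgn (fun k => om k i 0).
  rewrite (_ : (fun k => _) =
      (fun k => om 0%N i 0 + series (telescope (fun k => om k i 0)) k)); last first.
    by apply/funext => k; rewrite -eq_sum_telescope.
  apply: is_cvgD; first exact: is_cvg_cst.
  apply: normed_cvg.
  apply: (@series_le_cvg _ _ (geometric d q)) => [k|k|k|] /=.
  - exact: normr_ge0.
  - by rewrite mulr_ge0 ?exprn_ge0 ?l2norm_ge0.
  - apply: le_trans (om_step k); rewrite /telescope.
    by have := normr_coord_le (om k.+1 - om k) i; rewrite !mxE.
  - by apply: is_cvg_geometric_series; rewrite ger0_norm.
pose l : 'cV[R]_n := \col_i limn (fun k => om k i 0).
have om_l e : 0 < e -> \forall k \near \oo, l2norm (l - om k) <= n%:R * e.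
  move=> e0.
  have : \forall k \near \oo, forall i, `|l i 0 - om k i 0| <= e.
    apply: filter_forall => i; rewrite mxE.
    by move/cvgrPdist_le : (cvg_om i) => /(_ e e0).
  apply: filterS => k kP; apply: le_trans (l2norm_le_sum _) _.
  rewrite mulr_natl -[X in _ *+ X]card_ord -sumr_const.
  by apply: ler_sum => i _; rewrite !mxE; have := kP i; rewrite mxE.
exists l; apply/eqP; rewrite -subr_eq0; apply/eqP/l2norm_eq0.
apply/eqP; rewrite eq_le l2norm_ge0 andbT.
apply: (@le_of_small_linear _ _ _ (2 * n%:R)) => [|e /andP[e0 _]].
  by rewrite mulr_ge0.
have [N _ NP] := om_l e e0.
have le1 := NP N (leqnn _); have le2 := NP N.+1 (leqnSn _).
rewrite add0r -(subrKA (om N.+1)); apply: le_trans (ler_l2normD _ _) _.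
rewrite {1}/om iterS [l2norm (om N.+1 - l)]l2normBC.
have := Fq l (om N); have := l2norm_ge0 (l - om N); rewrite -/(om N); nra.
Qed.

End FixedPoint.

Section InnerProblem.
Variables (R : realType) (n : nat) (g : 'cV[R]_n -> R) (G : 'cV[R]_n -> 'cV[R]_n).
Variables (H : 'cV[R]_n -> 'M[R]_n) (lg mu eta : R).
Hypotheses (gG : forall b, is_grad_on setT g b (G b)).
Hypothesis (GH : forall b, is_jacobian_on setT G b (H b)).
Hypothesis (G_lip : forall a b, l2norm (G a - G b) <= lg * l2norm (a - b)).
Hypothesis (g_sc : strongly_convex_on setT mu g).
Hypotheses (lg_gt0 : 0 < lg) (mu_gt0 : 0 < mu) (eta_gt0 : 0 < eta).
Hypotheses (eta_lg : eta * lg <= 1) (eta_mu : eta * mu < 1).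
Implicit Types (a b u v z : 'cV[R]_n).

Lemma gradient_ineq a b :
  g a + dotp (G a) (b - a) + mu / 2 * l2norm (b - a) ^+ 2 <= g b.
Proof. by apply: (@strongly_convex_grad _ _ setT) => //; exact: ltW. Qed.

Lemma gradient_strong_mono a b :
  mu * l2norm (a - b) ^+ 2 <= dotp (G a - G b) (a - b).
Proof.
have := gradient_ineq a b; have := gradient_ineq b a.
rewrite (l2normBC b a) -(opprB a b) dotpNr dotpBl; lra.
Qed.

Lemma gradient_dist_ge a b : mu * l2norm (a - b) <= l2norm (G a - G b).
Proof.
have := le_trans (gradient_strong_mono a b) (dotp_le _ _).
have [->|ab] := eqVneq (l2norm (a - b)) 0; first by move=> _; rewrite mulr0 l2norm_ge0.
by rewrite expr2 mulrA ler_pM2r// lt_neqAle eq_sym ab l2norm_ge0.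
Qed.

(** With z := H u, the pairing <z, H u> is the derivative of <z, G> in direction u, so the Lipschitz
    constant of G bounds it by lg |u| |z|. *)
Lemma hessian_bound b u : l2norm (H b *m u) <= lg * l2norm u.
Proof.
apply: l2norm_le_dotp; first by rewrite mulr_ge0 ?l2norm_ge0// ltW.
set z := H b *m u; rewrite -[z in dotp z _]/(H b *m u) dotpC -[H b]trmxK.
rewrite -dotp_mulmx.
apply: (grad_on_dir_le (lexx 0) (jacobian_dotp z (GH b))) => // s /andP[s0 _].
rewrite mul0r addr0 -dotpBr; apply: le_trans (dotp_le _ _) _.
have := G_lip (b + s *: u) b; rewrite [b + _]addrC addrK l2normZ gtr0_norm//.
have := l2norm_ge0 z; have := l2norm_ge0 u; nra.
Qed.

Lemma hessian_ge b u : mu * l2norm u ^+ 2 <= dotp (H b *m u) u.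
Proof.
rewrite dotpC -[H b]trmxK -dotp_mulmx.
apply: (grad_on_dir_ge (lexx 0) (jacobian_dotp u (GH b))) => // s /andP[s0 _].
rewrite mul0r subr0 -dotpBr.
have := gradient_strong_mono (b + s *: u) b.
rewrite [b + _]addrC addrK l2normZ gtr0_norm// dotpZr dotpC.
by rewrite exprMn mulrCA expr2 -mulrA ler_pM2l// => /le_trans->.
Qed.

(* Up to an error O(e s^2), the mixed second difference of g along su and sv is
   s^2 <H u, v>; it is symmetric in u and v. *)
Lemma second_difference z u v e : 0 < e -> exists2 d, 0 < d &
  forall s, 0 < s -> s * (l2norm u + l2norm v) < d ->
  `|(g (z + s *: u + s *: v) - g (z + s *: v)) - (g (z + s *: u) - g z)
    - s ^+ 2 * dotp (H z *m u) v| <= 2 * e * s ^+ 2 * (l2norm u + l2norm v) ^+ 2.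
Proof.
move=> e0; have /is_jacobian_onP/(_ e e0)[d d0 dP] := GH z.
exists d => // s s0 sd.
(* The mixed difference is psi(1) - psi(0). The derivative of psi pairs a difference of two values
   of G with sv, and both values are expanded around the single point z. *)
pose psi (t : R^o) : R^o := g (z + s *: u + t *: (s *: v)) - g (z + t *: (s *: v)).
pose dpsi (t : R^o) : R^o := dotp (G (z + s *: u + t *: (s *: v))) (s *: v)
  - dotp (G (z + t *: (s *: v))) (s *: v).
have psiE (t : R^o) : is_derive t 1 psi (dpsi t).
  by apply: is_deriveB; exact: grad_on_line_is_derive.
set N := l2norm u + l2norm v in sd *.
have [u0 v0] : 0 <= l2norm u /\ 0 <= l2norm v by split; exact: l2norm_ge0.
have le_eN w : l2norm w <= s * N -> l2norm (G (z + w) - G z - H z *m w) <= e * (s * N).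
  move=> wN; have := dP (z + w) I; rewrite [z + w]addrC addrK => /(_ (le_lt_trans wN sd)).
  by move=> /le_trans; apply; rewrite ler_wpM2l// ltW.
have := mean_value_dist_le psiE.
move=> /(_ (s ^+ 2 * dotp (H z *m u) v) (2 * e * s ^+ 2 * N ^+ 2)).
rewrite /psi !scale1r !scale0r !addr0 opprB addrA; apply => t /andP[t0 t1].
have sv : t * (s * l2norm v) <= s * l2norm v by rewrite ler_piMl// mulr_ge0// ltW.
have su : 0 <= s * l2norm u by rewrite mulr_ge0// ltW.
have w1 : l2norm (s *: u + t *: (s *: v)) <= s * N.
  apply: le_trans (ler_l2normD _ _) _; rewrite !l2normZ !ger0_norm ?(ltW s0)//.
  by rewrite /N mulrDr lerD2l.
have w2 : l2norm (t *: (s *: v)) <= s * N.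
  by rewrite !l2normZ !ger0_norm ?(ltW s0)// /N mulrDr (le_trans sv)// lerDr.
have := le_eN _ w1; have := le_eN _ w2.
rewrite mulmxDr -!scalemxAr [z + (_ + _)]addrA.
set G1 := G (z + t *: _); set G2 := G (z + s *: u + _).
set A := H z *m u; set B := H z *m v => h2 h1.
have -> : dpsi t - s ^+ 2 * dotp A v =
    dotp ((G2 - G z - (s *: A + t *: (s *: B))) - (G1 - G z - t *: (s *: B))) (s *: v).
  rewrite /dpsi -/G1 -/G2 !(dotpBl, dotpNl, dotpDl, dotpZl, dotpZr); ring.
apply: le_trans (normr_dotp_le _ _) _; rewrite l2normZ gtr0_norm//.
have h3 := ler_l2normB (G2 - G z - (s *: A + t *: (s *: B))) (G1 - G z - t *: (s *: B)).
apply: le_trans (ler_wpM2r _ (le_trans h3 (lerD h1 h2))) _; first by rewrite mulr_ge0// ltW.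
have -> : (e * (s * N) + e * (s * N)) * (s * l2norm v)
  = 2 * e * s ^+ 2 * (N * l2norm v) by ring.
by rewrite ler_wpM2l ?mulr_ge0 ?exprn_ge0 ?(ltW s0) ?(ltW e0)// expr2 /N; nra.
Qed.

(** The mixed difference is the same number for (u, v) and (v, u), so s^2 <H u, v> and s^2 <H v, u>
    differ by at most 4 e s^2 (|u| + |v|)^2; exchanging the roles gives equality. *)
Lemma hessian_sym_le z u v : dotp (H z *m u) v <= dotp (H z *m v) u.
Proof.
set N := l2norm u + l2norm v.
apply: (@le_of_small_linear _ _ _ (4 * N ^+ 2)) => [|e /andP[e0 _]].
  by rewrite mulr_ge0 ?sqr_ge0.
have [d d0 dP] := second_difference z u v e0.
have [d' d'0 dP'] := second_difference z v u e0.
have N0 : 0 <= N by rewrite addr_ge0 ?l2norm_ge0.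
pose s := Num.min d d' / (N + 1).
have m0 : 0 < Num.min d d' by rewrite lt_min d0.
have s0 : 0 < s by rewrite divr_gt0//; lra.
have sN : s * N < Num.min d d'.
  by rewrite /s mulrAC ltr_pdivrMr; nra.
have := dP s s0; rewrite -/N => /(_ _)/ler_normlP[|].
  by rewrite (lt_le_trans sN)// ge_min lexx.
have := dP' s s0; rewrite [l2norm v + _]addrC -/N => /(_ _)/ler_normlP[|].
  by rewrite (lt_le_trans sN)// ge_min lexx orbT.
rewrite [z + s *: v + s *: u]addrAC => _ h1 h2 _.
have : s ^+ 2 * dotp (H z *m u) v <= s ^+ 2 * (dotp (H z *m v) u + 4 * N ^+ 2 * e) by lra.
by rewrite ler_pM2l// exprn_gt0.
Qed.

Lemma hessian_sym z : (H z)^T = H z.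
Proof.
apply/matrixP => i j; rewrite mxE.
have E k l : H z k l = dotp (H z *m delta_mx l 0) (delta_mx k 0).
  rewrite -colE /dotp (bigD1 k)//= big1 ?addr0; first by rewrite !mxE !eqxx mulr1.
  by move=> m /negPf mk; rewrite !mxE mk mulr0.
by rewrite !E; apply/eqP; rewrite eq_le !hessian_sym_le.
Qed.

(** M := I - eta H is positive semidefinite because eta lg <= 1, and <M v, v> <= x |v|^2. The
    generalized Cauchy-Schwarz inequality for u and M u then gives |M u|^4 <= <M u, u> <M M u, M u>
    <= x^2 |u|^2 |M u|^2. *)
Lemma gd_jacobian_bound b u :
  l2norm ((1%:M - eta *: H b) *m u) <= (1 - eta * mu) * l2norm u.
Proof.
set M := 1%:M - eta *: H b; set x := 1 - eta * mu.
have x0 : 0 <= x by rewrite subr_ge0 ltW.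
have MdotE v : dotp (M *m v) v = l2norm v ^+ 2 - eta * dotp (H b *m v) v.
  by rewrite /M mulmxBl mul1mx -scalemxAl dotpBl dotpZl l2norm_sqr.
have M_ge0 v : 0 <= dotp (M *m v) v.
  rewrite MdotE subr_ge0.
  have h1 : dotp (H b *m v) v <= lg * l2norm v ^+ 2.
    rewrite expr2 mulrA (le_trans (dotp_le _ _))//.
    by rewrite ler_wpM2r ?l2norm_ge0 ?hessian_bound.
  apply: le_trans (ler_wpM2l (ltW eta_gt0) h1) _.
  by rewrite mulrA ler_piMl ?sqr_ge0.
have M_le v : dotp (M *m v) v <= x * l2norm v ^+ 2.
  rewrite MdotE /x mulrBl mul1r lerD2l lerN2 -mulrA ler_wpM2l ?hessian_ge//.
  exact: ltW.
have symM : M^T = M by rewrite /M linearB /= linearZ /= trmx1 hessian_sym.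
have := psd_CauchySchwarz u (M *m u) symM M_ge0.
move=> /le_trans/(_ (ler_pM (M_ge0 _) (M_ge0 _) (M_le _) (M_le _))).
rewrite -l2norm_sqr; set a := l2norm (M *m u); set c := l2norm u.
have [a0 c0] : 0 <= a /\ 0 <= c by split; exact: l2norm_ge0.
have [->|a_neq0] := eqVneq a 0; first by rewrite mulr_ge0.
have {}a0 : 0 < a by rewrite lt_neqAle eq_sym a_neq0.
move=> h; rewrite -(@ler_pXn2r _ 2) ?nnegrE ?mulr_ge0 ?(ltW a0)//.
rewrite -(@ler_pM2r _ (a ^+ 2)) ?exprn_gt0// -expr2 (le_trans h)//.
by rewrite le_eqVlt; apply/orP; left; apply/eqP; ring.
Qed.

Definition gd_step b := b - eta *: G b.

(** Mean value theorem for the scalar function <z, gd_step> on the segment from b to a, where z is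
    the difference to be bounded. *)
Lemma gd_step_contraction a b :
  l2norm (gd_step a - gd_step b) <= (1 - eta * mu) * l2norm (a - b).
Proof.
have x0 : 0 <= 1 - eta * mu by rewrite subr_ge0 ltW.
apply: l2norm_le_dotp; first by rewrite mulr_ge0 ?l2norm_ge0.
set z := gd_step a - gd_step b.
have gd_grad y : is_grad_on setT (fun y => dotp z (gd_step y)) y
    ((1%:M - eta *: H y)^T *m z).
  apply: jacobian_dotp; apply/is_jacobian_onP => e e0.
  have /is_jacobian_onP/(_ (e / eta))[|d d0 dP] := GH y; first by rewrite divr_gt0.
  exists d => // y' _ /(dP y' I) h.
  rewrite (_ : _ - _ = - eta *: (G y' - G y - H y *m (y' - y))).
    rewrite l2normZ normrN gtr0_norm//.
    by move: h; rewrite mulrAC ler_pdivlMr// mulrC.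
  rewrite /gd_step mulmxBl mul1mx -scalemxAl scaleNr !scalerBr !opprB.
  by apply/colP => i; rewrite !mxE; ring.
have := mean_value_dist_le (fun s => grad_on_line_is_derive b (a - b) s gd_grad).
move=> /(_ 0 ((1 - eta * mu) * l2norm (a - b) * l2norm z)).
rewrite !subr0 scale1r scale0r addr0 [b + (a - b)]addrC subrK -dotpBr -/z => h.
apply: le_trans (ler_norm _) _; apply: h => s _.
rewrite subr0 dotp_mulmx trmxK (le_trans (normr_dotp_le _ _))//.
by rewrite mulrC ler_wpM2r ?l2norm_ge0// gd_jacobian_bound.
Qed.

(** Existence of the inner minimizer comes from the fixed point of the gradient step rather than
    from coercivity and compactness. *)
Lemma critical_point_exists : exists b, G b = 0.
Proof.
have [|b bE] := l2norm_contraction_fixpoint _ gd_step_contraction.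
  by have := mulr_gt0 eta_gt0 mu_gt0; move: eta_mu; lra.
exists b; move: bE => /(congr1 (fun c => b - c)); rewrite subrr.
rewrite /gd_step opprB addrC subrK => /eqP; rewrite scaler_eq0 gt_eqF//=.
by move/eqP.
Qed.

Lemma critical_argmin b : G b = 0 -> is_argmin setT g b.
Proof.
move=> Gb0; split=> // y _; have := gradient_ineq b y.
by rewrite Gb0 dotp0l addr0 => /(le_trans _); apply; rewrite lerDl mulr_ge0 ?sqr_ge0 ?divr_ge0 ?ltW.
Qed.

(** Strong convexity around an existing critical point c gives mu/2 |b - c|^2 <= 0 for any minimizer
    b. *)
Lemma argmin_critical b : is_argmin setT g b -> G b = 0.
Proof.
move=> [_ bmin]; have [c Gc] := critical_point_exists.
suff -> : b = c by [].
apply/eqP; rewrite -subr_eq0; apply/eqP/l2norm_eq0.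
have := gradient_ineq c b; rewrite Gc dotp0l addr0; have := bmin c I.
move=> h1 h2; have : mu / 2 * l2norm (b - c) ^+ 2 <= 0 by lra.
rewrite pmulr_rle0 ?divr_gt0// => h3; apply/eqP; rewrite -sqrf_eq0 eq_le h3.
exact: sqr_ge0.
Qed.

Lemma hessian_unit b : H b \in unitmx.
Proof.
rewrite -row_free_unit -[H b]hessian_sym; apply: inj_row_free => v /(congr1 trmx).
rewrite trmx0 trmx_mul trmxK => Hv0.
have := hessian_ge b v^T; rewrite Hv0 dotp0l pmulr_rle0// => h.
apply: trmx_inj; rewrite trmx0; apply/l2norm_eq0/eqP.
by rewrite -sqrf_eq0 eq_le h sqr_ge0.
Qed.

Lemma invmx_hessian_bound b u : l2norm (invmx (H b) *m u) <= mu^-1 * l2norm u.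
Proof.
set c := invmx _ *m u; have Hc : H b *m c = u by rewrite mulKVmx// hessian_unit.
have := le_trans (hessian_ge b c) (dotp_le _ _); rewrite Hc expr2 mulrA.
rewrite ler_pdivlMl//.
have [->|c0] := eqVneq (l2norm c) 0.
  by move=> _; rewrite mulr0 l2norm_ge0.
by rewrite ler_pM2r// lt_neqAle eq_sym c0 l2norm_ge0.
Qed.

End InnerProblem.

(** * Hypergradient of one round *)

(** Splits the exponent of q^(K-1): the k-th inner iterate contributes q^k, and the product over j >
    k contributes q^(K-k-1). *)
Lemma predn_split k K : (k < K)%N -> K.-1 = (k + (K - k.+1))%N.
Proof. by case: K => // K kK; rewrite subSS subnKC. Qed.

Section Convexity.
Variable R : realType.

Lemma convex_set_segment n (X : set 'cV[R]_n) x y s : convex_set X ->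
  X x -> X y -> 0 <= s <= 1 -> X (s *: x + (1 - s) *: y).
Proof.
move=> cX Xx Xy s01.
have := cX x y (Itv01 (andP s01).1 (andP s01).2); rewrite !inE => /(_ Xx Xy).
by rewrite /conv /=.
Qed.

Lemma convex_function_segment n (X : set 'cV[R]_n) (h : 'cV[R]_n -> R) x y s :
  convex_function X h ->
  X x -> X y -> 0 <= s <= 1 ->
  h (s *: x + (1 - s) *: y) <= s * h x + (1 - s) * h y.
Proof.
move=> ch Xx Xy s01.
have := ch (Itv01 (andP s01).1 (andP s01).2) x y; rewrite !inE => /(_ Xx Xy).
by rewrite /conv /=.
Qed.

(** Both vectors describe the same increment of f along the segment from x to y up to o(s), so their
    difference pairs with y - x to something below every e |y - x|, with either sign. *)
Lemma is_grad_on_dotp_eq n (X : set 'cV[R]_n) f x v v' y : convex_set X ->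
  is_grad_on X f x v -> is_grad_on X f x v' -> X x -> X y ->
  dotp v (y - x) = dotp v' (y - x).
Proof.
move=> cX /is_grad_onP vP /is_grad_onP v'P Xx Xy.
suff le0 w : (forall e, 0 < e -> exists2 d, 0 < d &
    forall y, X y -> l2norm (y - x) < d -> dotp w (y - x) <= e * l2norm (y - x)) ->
    dotp w (y - x) <= 0.
  apply/eqP; rewrite -subr_eq0 -dotpBl eq_le -oppr_le0 -dotpNl.
  apply/andP; split; apply: le0 => e e0.
    have [d d0 dP] := vP _ (divr_gt0 e0 (ltr0Sn R 1)).
    have [d' d'0 d'P] := v'P _ (divr_gt0 e0 (ltr0Sn R 1)).
    exists (Num.min d d') => [|z Xz]; first by rewrite lt_min d0.
    rewrite lt_min => /andP[/(dP _ Xz)/ler_normlP[h1 h2] /(d'P _ Xz)/ler_normlP[h3 h4]].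
    by rewrite dotpBl; lra.
  have [d d0 dP] := vP _ (divr_gt0 e0 (ltr0Sn R 1)).
  have [d' d'0 d'P] := v'P _ (divr_gt0 e0 (ltr0Sn R 1)).
  exists (Num.min d d') => [|z Xz]; first by rewrite lt_min d0.
  rewrite lt_min => /andP[/(dP _ Xz)/ler_normlP[h1 h2] /(d'P _ Xz)/ler_normlP[h3 h4]].
  by rewrite dotpNl dotpBl; lra.
move=> wP; have N0 := l2norm_ge0 (y - x).
apply: (@le_of_small_linear _ _ _ (l2norm (y - x))) => // e /andP[e0 _].
have [d d0 dP] := wP e e0.
pose s := Num.min 1 (d / (2 * (l2norm (y - x) + 1))).
have s0 : 0 < s by rewrite lt_min ltr01 divr_gt0//; lra.
have s1 : s <= 1 by rewrite ge_min lexx.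
have sd : s * l2norm (y - x) < d.
  have : s <= d / (2 * (l2norm (y - x) + 1)) by rewrite ge_min lexx orbT.
  by rewrite ler_pdivlMr; nra.
have := dP (s *: y + (1 - s) *: x) (convex_set_segment cX Xy Xx _).
have -> : s *: y + (1 - s) *: x - x = s *: (y - x).
  by apply/colP => i; rewrite !mxE; ring.
rewrite l2normZ gtr0_norm// dotpZr (ltW s0) s1 => /(_ isT sd).
by rewrite mulrCA ler_pM2l// add0r mulrC.
Qed.

End Convexity.

Section BilevelRound.
Variables (R : realType) (d1 d2 : nat) (X : set 'cV[R]_d1).
Variables (lf0 lf1 lg1 lg2 mu eta : R).
Variables (f g : 'cV[R]_(d1 + d2) -> R).
Variables (df dg : 'cV[R]_(d1 + d2) -> 'cV[R]_(d1 + d2)).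
Variables (dglb : 'cV[R]_(d1 + d2) -> 'M[R]_(d1, d2)).
Variables (dgbb : 'cV[R]_(d1 + d2) -> 'M[R]_d2).
Hypotheses (X_convex : convex_set X).
Hypothesis f_reg : outer_regular X lf0 lf1 f df.
Hypothesis g_reg : inner_regular X lg1 lg2 g dg dglb dgbb.
Hypothesis g_sc :
  forall l, X l -> strongly_convex_on setT mu (fun b => g (col_mx l b)).
Hypotheses (lf0_ge0 : 0 <= lf0) (lf1_ge0 : 0 <= lf1) (lg2_ge0 : 0 <= lg2).
Hypotheses (lg1_gt0 : 0 < lg1) (mu_gt0 : 0 < mu) (eta_gt0 : 0 < eta).
Hypotheses (eta_lg1 : eta * lg1 <= 1) (eta_mu : eta * mu < 1).
Implicit Types (l y : 'cV[R]_d1) (b r : 'cV[R]_d2) (z : 'cV[R]_(d1 + d2)).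

Let D := joint_domain X : set 'cV[R]_(d1 + d2).

Lemma joint_domain_col_mx l b : X l -> D (col_mx l b).
Proof. by rewrite /D /joint_domain /= col_mxKu. Qed.

Lemma inner_grad l b : X l ->
  is_grad_on setT (fun b => g (col_mx l b)) b (dsubmx (dg (col_mx l b))).
Proof.
move=> Xl; have [/(_ _ (joint_domain_col_mx b Xl))/is_grad_onP dgP _ _ _ _] := g_reg.
apply/is_grad_onP => e /dgP[d d0 dP]; exists d => // y _.
have := dP (col_mx l y) (joint_domain_col_mx y Xl).
rewrite opp_col_mx add_col_mx subrr l2norm_col_mx_r.
by rewrite -[in dotp (dg _)](vsubmxK (dg (col_mx l b))) dotp_col_mx dotp0r add0r.
Qed.

Lemma inner_jacobian l b : X l ->
  is_jacobian_on setT (fun b => dsubmx (dg (col_mx l b))) b (dgbb (col_mx l b)).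
Proof.
move=> Xl; have [_ /(_ _ (joint_domain_col_mx b Xl))/is_jacobian_onP dgP _ _ _] := g_reg.
apply/is_jacobian_onP => e /dgP[d d0 dP]; exists d => // y _.
have := dP (col_mx l y) (joint_domain_col_mx y Xl).
rewrite opp_col_mx add_col_mx subrr l2norm_col_mx_r.
by rewrite mul_row_col mulmx0 add0r.
Qed.

Lemma inner_grad_lip l l' b b' : X l -> X l' ->
  l2norm (dsubmx (dg (col_mx l b)) - dsubmx (dg (col_mx l' b'))) <=
    lg1 * l2norm (col_mx l b - col_mx l' b').
Proof.
move=> Xl Xl'; have [_ _ dg_lip _ _] := g_reg.
rewrite -linearB /= (le_trans (l2norm_dsubmx _))//.
by apply: dg_lip; exact: joint_domain_col_mx.
Qed.

Lemma inner_grad_lip_r l b b' : X l ->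
  l2norm (dsubmx (dg (col_mx l b)) - dsubmx (dg (col_mx l b'))) <=
    lg1 * l2norm (b - b').
Proof.
move=> Xl; have := inner_grad_lip b b' Xl Xl.
by rewrite opp_col_mx add_col_mx subrr l2norm_col_mx_r.
Qed.

Let bh := beta_hat g.

(** [beta_hat] is an [xget] with default 0; the critical point found above shows that it is a
    genuine minimizer. *)
Lemma beta_hat_critical l : X l -> dsubmx (dg (col_mx l (bh l))) = 0.
Proof.
move=> Xl.
have gG b := inner_grad b Xl; have GH b := inner_jacobian b Xl.
have Glip b b' := inner_grad_lip_r b b' Xl.
apply: (argmin_critical gG GH Glip (g_sc Xl) lg1_gt0 mu_gt0 eta_gt0 eta_lg1 eta_mu).
have [b Gb] := critical_point_exists gG GH Glip (g_sc Xl) lg1_gt0 mu_gt0 eta_gt0 eta_lg1 eta_mu.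
rewrite /bh /beta_hat; apply: (@xgetPex _ _ [set b | is_argmin _ _ b]); exists b.
exact: (critical_argmin gG (g_sc Xl) mu_gt0 Gb).
Qed.

(** Strong monotonicity at l bounds mu |bh l - bh l'| by the gradient at (l, bh l'), which vanishes
    when l is replaced by l'. *)
Lemma beta_hat_lip l l' : X l -> X l' ->
  l2norm (bh l - bh l') <= kappa lg1 mu * l2norm (l - l').
Proof.
move=> Xl Xl'; rewrite /kappa mulrAC ler_pdivlMr// mulrC.
have := gradient_dist_ge (fun b => inner_grad b Xl) (g_sc Xl) mu_gt0 (bh l) (bh l').
rewrite beta_hat_critical// sub0r l2normN => /le_trans; apply.
have := inner_grad_lip (bh l') (bh l') Xl Xl'.
by rewrite (beta_hat_critical Xl') subr0 opp_col_mx add_col_mx subrr l2norm_col_mx_l.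
Qed.

(** This is 1 <= kappa, multiplied by a norm so that it also holds for d2 = 0, where lg1 and mu are
    unrelated. It puts kappa^2 in front of H_{2,T}. *)
Lemma le_kappa_l2norm b : X !=set0 -> l2norm b <= kappa lg1 mu * l2norm b.
Proof.
move=> [l Xl]; rewrite /kappa mulrAC ler_pdivlMr// mulrC.
have := gradient_dist_ge (fun b => inner_grad b Xl) (g_sc Xl) mu_gt0 b 0.
by rewrite subr0 => /le_trans; apply; have := inner_grad_lip_r b 0 Xl; rewrite subr0.
Qed.

Lemma outer_grad_lip l b b' : X l ->
  l2norm (df (col_mx l b) - df (col_mx l b')) <= lf1 * l2norm (b - b').
Proof.
move=> Xl; have [_ _ df_lip] := f_reg.
have := df_lip (col_mx l b) (col_mx l b'); rewrite opp_col_mx add_col_mx subrr.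
by rewrite l2norm_col_mx_r; apply; exact: joint_domain_col_mx.
Qed.

(** Directions in beta never leave the joint domain, so here, unlike for lambda, the norm itself is
    controlled. *)
Lemma outer_grad_beta_bound l b : X l -> l2norm (dsubmx (df (col_mx l b))) <= lf0.
Proof.
move=> Xl; have [dfP f_lip _] := f_reg.
apply: l2norm_le_dotp => //; set v := dsubmx _.
have -> : dotp v v = dotp (df (col_mx l b)) (col_mx 0 v).
  by rewrite -[df _]vsubmxK dotp_col_mx dotp0r add0r.
have E s : col_mx l b + s *: col_mx 0 v = col_mx l (b + s *: v).
  by rewrite scale_col_mx scaler0 add_col_mx addr0.
apply: (grad_on_dir_le (lexx 0) (dfP _ (joint_domain_col_mx b Xl))) => s.
  by rewrite E => _; exact: joint_domain_col_mx.
move=> /andP[s0 _]; rewrite mul0r addr0 E (le_trans (ler_norm _))//.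
have := f_lip (col_mx l (b + s *: v)) (col_mx l b).
rewrite opp_col_mx add_col_mx subrr l2norm_col_mx_r [b + _]addrC addrK l2normZ (gtr0_norm s0).
by rewrite mulrCA; apply; exact: joint_domain_col_mx.
Qed.

(* At [l] itself the segment towards [y - y'] may leave X, but it does not at the
   nearby point [(1 - s) l + s y']. *)
Lemma partial_grad_bound (F : 'cV[R]_(d1 + d2) -> R)
    (dF : 'cV[R]_(d1 + d2) -> 'cV[R]_(d1 + d2)) c L l b y y' :
  0 <= L ->
  (forall z, D z -> is_grad_on D F z (dF z)) ->
  (forall z z', D z -> D z' -> F z - F z' <= c * l2norm (z - z')) ->
  (forall l', X l' -> l2norm (usubmx (dF (col_mx l b)) - usubmx (dF (col_mx l' b)))
     <= L * l2norm (l - l')) ->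
  X l -> X y -> X y' ->
  dotp (usubmx (dF (col_mx l b))) (y - y') <= c * l2norm (y - y').
Proof.
move=> L0 dFP F_lip dF_lip Xl Xy Xy'; set u := y - y'.
(* The small parameter s is also the ratio by which l is moved towards y'; passing to the new base
   point costs at most L s |l - y'| |u|. *)
apply: (@le_of_small_linear _ _ _ (L * l2norm (l - y') * l2norm u)).
  by rewrite !mulr_ge0 ?l2norm_ge0.
move=> s /andP[s0 s1]; pose p := s *: y' + (1 - s) *: l.
have Xp : X p by apply: convex_set_segment => //; rewrite (ltW s0).
have lp : l - p = s *: (l - y') by apply/colP => i; rewrite !mxE; ring.
have dF_p : dotp (usubmx (dF (col_mx p b))) u <= c * l2norm u.
  have -> : dotp (usubmx (dF (col_mx p b))) u =
      s^-1 * dotp (dF (col_mx p b)) (col_mx (s *: u) 0).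
    rewrite -[in RHS](vsubmxK (dF _)) dotp_col_mx dotp0r addr0 dotpZr mulrA.
    by rewrite mulVf ?mul1r// gt_eqF.
  rewrite ler_pdivrMl//.
  have E t : col_mx p b + t *: col_mx (s *: u) 0 = col_mx (p + t *: (s *: u)) b.
    by rewrite scale_col_mx scaler0 add_col_mx addr0.
  have Xpt t : 0 < t <= 1 -> X (p + t *: (s *: u)).
    move=> /andP[t0 t1].
    have -> : p + t *: (s *: u) = s *: (t *: y + (1 - t) *: y') + (1 - s) *: l.
      by apply/colP => i; rewrite !mxE; ring.
    apply: convex_set_segment => //; last by rewrite (ltW s0).
    by apply: convex_set_segment => //; rewrite (ltW t0).
  apply: (grad_on_dir_le (lexx 0) (dFP _ (joint_domain_col_mx b Xp))) => t.
    by move=> t01; rewrite E; apply: joint_domain_col_mx; exact: Xpt.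
  move=> /[dup] /Xpt Xt /andP[t0 t1]; rewrite mul0r addr0 E.
  have := F_lip (col_mx (p + t *: (s *: u)) b) (col_mx p b).
  rewrite opp_col_mx add_col_mx subrr l2norm_col_mx_l [p + _]addrC addrK.
  rewrite !l2normZ !gtr0_norm// => F_le.
  have -> : t * (s * (c * l2norm u)) = c * (t * (s * l2norm u)) by ring.
  apply: F_le; apply: joint_domain_col_mx => //.
  by rewrite addrC.
have -> : dotp (usubmx (dF (col_mx l b))) u = dotp (usubmx (dF (col_mx p b))) u
   + dotp (usubmx (dF (col_mx l b)) - usubmx (dF (col_mx p b))) u.
  by rewrite dotpBl addrC subrK.
apply: lerD => //; apply: le_trans (dotp_le _ _) _.
have := dF_lip p Xp; rewrite lp l2normZ gtr0_norm// => h.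
by apply: le_trans (ler_wpM2r (l2norm_ge0 _) h) _; lra.
Qed.

Lemma outer_grad_lambda_bound l b y y' : X l -> X y -> X y' ->
  dotp (usubmx (df (col_mx l b))) (y - y') <= lf0 * l2norm (y - y').
Proof.
move=> Xl Xy Xy'; have [dfP f_lip df_lip] := f_reg.
apply: (@partial_grad_bound f df lf0 lf1) => // [z z' Dz Dz'|l' Xl'].
  exact: le_trans (ler_norm _) (f_lip _ _ Dz Dz').
rewrite -linearB /= (le_trans (l2norm_usubmx _))//.
have := df_lip (col_mx l b) (col_mx l' b).
rewrite opp_col_mx add_col_mx subrr l2norm_col_mx_l.
by apply; exact: joint_domain_col_mx.
Qed.

Lemma cross_hessian_lip l l' b b' r : X l -> X l' ->
  l2norm ((dglb (col_mx l b) - dglb (col_mx l' b')) *m r) <=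
    lg2 * l2norm (col_mx l b - col_mx l' b') * l2norm r.
Proof.
move=> Xl Xl'; have [_ _ _ dglb_lip _] := g_reg.
rewrite (le_trans (l2norm_mulmx_le _ _))// ler_wpM2r ?l2norm_ge0//.
by apply: dglb_lip; exact: joint_domain_col_mx.
Qed.

Lemma inner_hessian_lip l b b' r : X l ->
  l2norm ((dgbb (col_mx l b) - dgbb (col_mx l b')) *m r) <=
    lg2 * l2norm (b - b') * l2norm r.
Proof.
move=> Xl; have [_ _ _ _ dgbb_lip] := g_reg.
rewrite (le_trans (l2norm_mulmx_le _ _))// ler_wpM2r ?l2norm_ge0//.
have := dgbb_lip (col_mx l b) (col_mx l b').
rewrite opp_col_mx add_col_mx subrr l2norm_col_mx_r.
by apply; exact: joint_domain_col_mx.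
Qed.

(** The vector dglb r is the lambda-part of the gradient of <r, grad_beta g>, a function with
    Lipschitz constant lg1 |r|. *)
Lemma cross_hessian_bound l b r y y' : X l -> X y -> X y' ->
  dotp (dglb (col_mx l b) *m r) (y - y') <= lg1 * l2norm r * l2norm (y - y').
Proof.
move=> Xl Xy Xy'; have [_ JP dg_lip _ _] := g_reg.
pose dF z := (row_mx (dglb z)^T (dgbb z))^T *m r.
have usub_dF z : usubmx (dF z) = dglb z *m r.
  by rewrite /dF tr_row_mx trmxK mul_col_mx col_mxKu.
rewrite -usub_dF.
apply: (@partial_grad_bound (fun z => dotp r (dsubmx (dg z))) dF _
   (lg2 * l2norm r)) => //.
- by rewrite mulr_ge0 ?l2norm_ge0.
- by move=> z Dz; exact: jacobian_dotp (JP z Dz).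
- move=> z z' Dz Dz'; rewrite -dotpBr -linearB /= (le_trans (dotp_le _ _))//.
  rewrite -mulrA mulrCA ler_wpM2l ?l2norm_ge0//.
  by rewrite (le_trans (l2norm_dsubmx _))// dg_lip.
- move=> l' Xl'; rewrite !usub_dF -mulmxBl.
  apply: le_trans (cross_hessian_lip _ _ _ Xl Xl') _.
  by rewrite opp_col_mx add_col_mx subrr l2norm_col_mx_l mulrAC.
Qed.

Let hinv l b : 'cV[R]_d2 := invmx (dgbb (col_mx l (bh l))) *m b.

Let zh l := col_mx l (bh l).

(** The hypergradient given by the implicit function theorem: the partial gradient in lambda
    corrected by the adjoint term of the inner problem. *)
Definition implicit_grad l : 'cV[R]_d1 :=
  usubmx (df (zh l)) - dglb (zh l) *m hinv l (dsubmx (df (zh l))).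

Let hinv_bound l b : X l -> l2norm (hinv l b) <= mu^-1 * l2norm b.
Proof.
move=> Xl; exact: (invmx_hessian_bound (fun b => inner_grad b Xl)
  (fun b => inner_jacobian b Xl) (g_sc Xl) mu_gt0).
Qed.

Lemma implicit_grad_bound l y y' : X l -> X y -> X y' ->
  dotp (implicit_grad l) (y - y') <= lf0 * (1 + kappa lg1 mu) * l2norm (y - y').
Proof.
move=> Xl Xy Xy'; rewrite dotpBl -dotpNr opprB mulrDr mulr1 mulrDl.
apply: lerD; first exact: outer_grad_lambda_bound.
apply: le_trans (cross_hessian_bound _ _ Xl Xy' Xy) _.
rewrite [l2norm (y' - y)]l2normBC ler_wpM2r ?l2norm_ge0// /kappa.
rewrite mulrCA ler_wpM2l ?(ltW lg1_gt0)// (le_trans (hinv_bound _ Xl))//.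
by rewrite mulrC ler_wpM2r ?invr_ge0 ?(ltW mu_gt0)// outer_grad_beta_bound.
Qed.

(** The gradient of g in beta vanishes at both [zh y] and [zh l], so its linearization J zd is
    small, and <c, J zd> may be added to the expansion of f. As H c is the beta-part of [df], the
    terms in bh y - bh l cancel and [implicit_grad] remains. *)
Lemma outer_obj_grad l : X l -> is_grad_on X (outer_obj f g) l (implicit_grad l).
Proof.
move=> Xl; have [dfP _ _] := f_reg; have [_ JP _ _ _] := g_reg.
have Dl : D (zh l) by exact: joint_domain_col_mx.
set c := hinv l (dsubmx (df (zh l))).
have Hc : dgbb (zh l) *m c = dsubmx (df (zh l)).
  by rewrite mulKVmx// (hessian_unit (fun b => inner_grad b Xl)
    (fun b => inner_jacobian b Xl) (g_sc Xl) mu_gt0).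
have symH : (dgbb (zh l))^T = dgbb (zh l).
  exact: (hessian_sym (fun b => inner_grad b Xl) (fun b => inner_jacobian b Xl)).
apply/is_grad_onP => e e0.
set k := kappa lg1 mu; have k0 : 0 <= k by rewrite divr_ge0 ?ltW.
have c0 := l2norm_ge0 c.
(* The expansions of f and of grad_beta g weigh 1 and |c|, and |zd| <= (1 + k) |y - l|. *)
pose e' := e / ((1 + l2norm c) * (1 + k)).
have den0 : 0 < (1 + l2norm c) * (1 + k) by nra.
have e'0 : 0 < e' by rewrite divr_gt0.
have /is_grad_onP/(_ e' e'0)[d d0 dP] := dfP _ Dl.
have /is_jacobian_onP/(_ e' e'0)[d' d'0 d'P] := JP _ Dl.
exists (Num.min d d' / (1 + k)) => [|y Xy].
  by rewrite divr_gt0 ?lt_min ?d0//; lra.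
rewrite ltr_pdivlMr; last by lra.
have zyl : l2norm (zh y - zh l) <= l2norm (y - l) * (1 + k).
  rewrite /zh opp_col_mx add_col_mx (le_trans (l2norm_col_mx_le _ _))//.
  by rewrite mulrDr mulr1 lerD2l mulrC beta_hat_lip.
rewrite lt_min => /andP[/(le_lt_trans zyl) yd /(le_lt_trans zyl) yd'].
have Dy : D (zh y) by exact: joint_domain_col_mx.
have := dP _ Dy yd; have := d'P _ Dy yd'.
rewrite /= !beta_hat_critical// subrr sub0r l2normN.
set zd := zh y - zh l => h2 h1.
have zdE : zd = col_mx (y - l) (bh y - bh l) by rewrite /zd opp_col_mx add_col_mx.
rewrite /outer_obj -/bh -/(zh y) -/(zh l).
have -> : f (zh y) - f (zh l) - dotp (implicit_grad l) (y - l) =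
    f (zh y) - f (zh l) - dotp (df (zh l)) zd
    + dotp c (row_mx (dglb (zh l))^T (dgbb (zh l)) *m zd).
  rewrite /implicit_grad -/c -[df (zh l)]vsubmxK zdE dotp_col_mx mul_row_col.
  rewrite col_mxKu dotpBl [dotp c (_ + _)]dotpDr dotp_mulmx -Hc (dotp_mulmx (dgbb _)) symH.
  by ring.
apply: le_trans (ler_normD _ _) _.
have h3 := normr_dotp_le c (row_mx (dglb (zh l))^T (dgbb (zh l)) *m zd).
apply: le_trans (lerD h1 (le_trans h3 (ler_wpM2l c0 h2))) _.
have : e' * (1 + l2norm c) * l2norm zd <= e' * (1 + l2norm c) * (l2norm (y - l) * (1 + k)).
  by rewrite ler_wpM2l// mulr_ge0 ?(ltW e'0)//; lra.
have -> : e' * (1 + l2norm c) * (l2norm (y - l) * (1 + k)) = e * l2norm (y - l).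
  by rewrite -[in RHS](divfK (lt0r_neq0 den0) e) -/e'; ring.
by lra.
Qed.

(** [grad_on] selects some gradient relative to X; uniqueness against y - l and y' - l extends to
    their difference. *)
Lemma dotp_grad_on_outer_obj l y y' : X l -> X y -> X y' ->
  dotp (grad_on X (outer_obj f g) l) (y - y') = dotp (implicit_grad l) (y - y').
Proof.
move=> Xl Xy Xy'.
have gradF : is_grad_on X (outer_obj f g) l (grad_on X (outer_obj f g) l).
  apply: (@xgetPex _ _ [set v | is_grad_on _ _ _ v]); exists (implicit_grad l).
  exact: outer_obj_grad.
have E y0 : X y0 -> _ := is_grad_on_dotp_eq X_convex gradF (outer_obj_grad Xl) Xl.
have -> : y - y' = (y - l) - (y' - l) by rewrite opprB addrA subrK.
by rewrite !(dotpBr _ (y - l)) !E.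
Qed.

Lemma l2norm_bigmul_le n (M : nat -> 'M[R]_n) q s (v : 'cV[R]_n) : 0 <= q ->
  (forall j u, l2norm (M j *m u) <= q * l2norm u) ->
  l2norm ((\big[mulmx/1%:M]_(j <- s) M j) *m v) <= q ^+ size s * l2norm v.
Proof.
move=> q0 Mq; elim: s => [|j s IH]; first by rewrite big_nil mul1mx expr0 mul1r.
rewrite big_cons -mulmxA (le_trans (Mq _ _))//= exprS -mulrA.
by rewrite ler_wpM2l.
Qed.

(* With r_k = prod_(j > k) (I - eta H_j) b the sum telescopes as
   eta sum_k H_k r_k = b - r_(-1), so that eta sum_k r_k approximates H^-1 b. *)
Lemma neumann_sum_error n (Hk : nat -> 'M[R]_n) (Hs : 'M[R]_n) (b bs : 'cV[R]_n)
    (r : nat -> 'cV[R]_n) (K : nat) (eps c : R) (q := 1 - eta * mu) :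
  Hs \in unitmx -> (forall u, l2norm (invmx Hs *m u) <= mu^-1 * l2norm u) ->
  (forall k u, l2norm ((1%:M - eta *: Hk k) *m u) <= q * l2norm u) ->
  (forall k u, l2norm ((Hs - Hk k) *m u) <= eps * q ^+ k * l2norm u) ->
  0 <= eps -> l2norm b <= c ->
  (forall k, r k = (\big[mulmx/1%:M]_(k.+1 <= j < K) (1%:M - eta *: Hk j)) *m b) ->
  l2norm (eta *: (\sum_(0 <= k < K) r k) - invmx Hs *m bs) <=
    mu^-1 * (l2norm (b - bs) + q ^+ K * c + K%:R * eta * eps * q ^+ K.-1 * c).
Proof.
move=> Hs_unit Hs_inv M_le H_le eps0 b_le rE.
have q0 : 0 <= q by rewrite subr_ge0 ltW.
pose P k := \big[mulmx/1%:M]_(k <= j < K) (1%:M - eta *: Hk j).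
have {}rE k : r k = P k.+1 *m b by rewrite rE.
have P_le k u : l2norm (P k *m u) <= q ^+ (K - k) * l2norm u.
  by have := l2norm_bigmul_le (index_iota k K) u q0 M_le; rewrite size_iota.
have sumE : \sum_(0 <= k < K) eta *: (Hk k *m r k) = b - P 0%N *m b.
  transitivity (P K *m b - P 0%N *m b); last by rewrite {1}/P big_geq// mul1mx.
  rewrite -(telescope_sumr (fun k => P k *m b))//.
  apply: eq_big_nat => k /andP[_ kK].
  have -> : P k = (1%:M - eta *: Hk k) *m P k.+1 by rewrite /P big_ltn.
  by rewrite -mulmxA mulmxBl mul1mx opprB addrC subrK -scalemxAl rE.
(* Applying Hs to the left side and writing Hs = Hk + (Hs - Hk) separates three errors: of the
   right-hand side, of truncation, and of the varying Hessians. *)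
have E : eta *: (\sum_(0 <= k < K) r k) - invmx Hs *m bs =
    invmx Hs *m ((b - bs) - P 0%N *m b + \sum_(0 <= k < K) eta *: ((Hs - Hk k) *m r k)).
  rewrite -[LHS](mulKmx Hs_unit); congr (_ *m _).
  rewrite mulmxBr mulKVmx// -scalemxAr mulmx_sumr.
  rewrite [b - bs - _]addrAC -sumE scaler_sumr addrAC -big_split /=; congr (_ - _).
  by apply: eq_bigr => k _; rewrite -scalerDr mulmxBl addrC subrK.
rewrite E (le_trans (Hs_inv _))// ler_wpM2l ?invr_ge0 ?(ltW mu_gt0)//.
apply: le_trans (ler_l2normD _ _) _; apply: lerD.
  apply: le_trans (ler_l2normB _ _) _; rewrite lerD2l.
  by have := P_le 0%N b; rewrite subn0 => /le_trans; apply; rewrite ler_wpM2l ?exprn_ge0.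
apply: le_trans (ler_l2norm_sum _ _ _) _.
have -> : K%:R * eta * eps * q ^+ K.-1 * c =
    \sum_(0 <= k < K) (eta * eps * q ^+ K.-1 * c).
  by rewrite sumr_const_nat subn0 -[RHS]mulr_natl; ring.
rewrite big_nat_cond [leRHS]big_nat_cond; apply: ler_sum => k /andP[/andP[_ kK] _].
rewrite l2normZ gtr0_norm// -!mulrA ler_wpM2l ?(ltW eta_gt0)//.
apply: le_trans (H_le _ _) _; rewrite -mulrA ler_wpM2l//.
rewrite (predn_split kK).
rewrite exprD -mulrA ler_wpM2l ?exprn_ge0// rE (le_trans (P_le _ _))//.
by rewrite ler_wpM2l ?exprn_ge0.
Qed.

Lemma inner_iter_dist l b k : X l ->
  l2norm (inner_iter dg eta l b k - bh l) <= (1 - eta * mu) ^+ k * l2norm (b - bh l).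
Proof.
move=> Xl.
have := gd_step_contraction (fun b => inner_grad b Xl) (fun b => inner_jacobian b Xl)
  (fun b b' => inner_grad_lip_r b b' Xl) (g_sc Xl) lg1_gt0 mu_gt0 eta_gt0 eta_lg1 eta_mu.
move=> /(l2norm_iter_contraction b (bh l) k) => h.
have fixE : iter k (gd_step (fun b => dsubmx (dg (col_mx l b))) eta) (bh l) = bh l.
  elim: k {h} => //= k ->.
  by rewrite /gd_step beta_hat_critical// scaler0 subr0.
by move: h; rewrite fixE; apply; rewrite subr_ge0 ltW.
Qed.

(** The part proportional to [delta] comes from evaluating derivatives at the iterates instead of
    the minimizer, directly (the 1) and through the inverse Hessian (the kappa). The last term is
    the truncation of the Neumann series, present even for [delta] = 0. *)
Definition hypergrad_err (K : nat) (delta : R) : R :=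
  (1 + kappa lg1 mu) * (lf1 * (1 - eta * mu) ^+ K
    + K%:R * eta * lf0 * lg2 * (1 - eta * mu) ^+ K.-1) * delta
  + kappa lg1 mu * lf0 * (1 - eta * mu) ^+ K.

Lemma hypergrad_error l b K y y' : X l -> X y -> X y' ->
  dotp (hypergrad df dg dglb dgbb eta K l b - implicit_grad l) (y - y') <=
    hypergrad_err K (l2norm (b - bh l)) * l2norm (y - y').
Proof.
move=> Xl Xy Xy'.
set om := inner_iter dg eta l b; set delta := l2norm (b - bh l).
set q := 1 - eta * mu.
have q0 : 0 <= q by rewrite subr_ge0 ltW.
have om_bh k : l2norm (om k - bh l) <= q ^+ k * delta by exact: inner_iter_dist.
set bK := dsubmx (df (col_mx l (om K))); set bs := dsubmx (df (zh l)).
pose Hk k := dgbb (col_mx l (om k)); pose Ak k := dglb (col_mx l (om k)).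
pose r k := (\big[mulmx/1%:M]_(k.+1 <= j < K) (1%:M - eta *: Hk j)) *m bK.
have M_le k u : l2norm ((1%:M - eta *: Hk k) *m u) <= q * l2norm u.
  exact: (gd_jacobian_bound (fun b => inner_grad b Xl) (fun b => inner_jacobian b Xl)
    (fun b b' => inner_grad_lip_r b b' Xl) (g_sc Xl) lg1_gt0 mu_gt0 eta_gt0 eta_lg1 eta_mu).
have bK_le : l2norm bK <= lf0 by exact: outer_grad_beta_bound.
have df_le : l2norm (df (col_mx l (om K)) - df (zh l)) <= lf1 * (q ^+ K * delta).
  by rewrite (le_trans (outer_grad_lip _ _ Xl))// ler_wpM2l.
have r_le k : l2norm (r k) <= q ^+ (K - k.+1) * lf0.
  have := l2norm_bigmul_le (index_iota k.+1 K) bK q0 M_le; rewrite size_iota.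
  by move=> /le_trans; apply; rewrite ler_wpM2l ?exprn_ge0.
set S := eta *: (\sum_(0 <= k < K) r k) - hinv l bs.
have S_le : l2norm S <= mu^-1 * (lf1 * (q ^+ K * delta) + q ^+ K * lf0 +
    K%:R * eta * (lg2 * delta) * q ^+ K.-1 * lf0).
  have Hs_unit : dgbb (zh l) \in unitmx.
    exact: (hessian_unit (fun b => inner_grad b Xl) (fun b => inner_jacobian b Xl)
      (g_sc Xl) mu_gt0).
  have := @neumann_sum_error _ Hk (dgbb (zh l)) bK bs r K (lg2 * delta) lf0 Hs_unit.
  move=> /(_ (fun u => hinv_bound u Xl) M_le) h.
  apply: le_trans (h _ _ bK_le (fun=> erefl)) _.
  - move=> k u; apply: le_trans (inner_hessian_lip _ _ _ Xl) _.
    rewrite ler_wpM2r ?l2norm_ge0// -mulrA ler_wpM2l// mulrC l2normBC.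
    exact: om_bh.
  - by rewrite mulr_ge0 ?l2norm_ge0.
  - rewrite ler_wpM2l ?invr_ge0 ?(ltW mu_gt0)// !lerD2r.
    by rewrite /bK /bs -linearB /= (le_trans (l2norm_dsubmx _)).
(* Three sources of error: the outer gradient, the cross derivatives along the iterates, and the
   Neumann error S seen through the limiting cross derivative. *)
have -> : hypergrad df dg dglb dgbb eta K l b - implicit_grad l =
    usubmx (df (col_mx l (om K)) - df (zh l))
    - eta *: (\sum_(0 <= k < K) (Ak k - dglb (zh l)) *m r k) - dglb (zh l) *m S.
  rewrite /hypergrad /implicit_grad -/om -/bs linearB /=.
  have -> : \sum_(0 <= k < K) (Ak k - dglb (zh l)) *m r k =
      \sum_(0 <= k < K) Ak k *m r k - dglb (zh l) *m (\sum_(0 <= k < K) r k).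
    rewrite mulmx_sumr -sumrB; apply: eq_bigr => k _; exact: mulmxBl.
  rewrite /S mulmxBr -scalemxAr.
  have -> : \sum_(0 <= k < K) Ak k *m r k = \sum_(0 <= k < K)
      dglb (col_mx l (om k)) *m
      (\big[mulmx/1%:M]_(k.+1 <= j < K) (1%:M - eta *: dgbb (col_mx l (om j)))) *m bK.
    by apply: eq_bigr => k _; rewrite mulmxA.
  by apply/colP => i; rewrite !mxE; ring.
rewrite !(dotpBl, dotpZl).
set N := l2norm (y - y'); have N0 : 0 <= N by exact: l2norm_ge0.
have h1 : dotp (usubmx (df (col_mx l (om K)) - df (zh l))) (y - y') <=
    lf1 * (q ^+ K * delta) * N.
  rewrite (le_trans (dotp_le _ _))// ler_wpM2r//.
  by rewrite (le_trans (l2norm_usubmx _)).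
have h2 : - (eta * dotp (\sum_(0 <= k < K) (Ak k - dglb (zh l)) *m r k) (y - y')) <=
    eta * (K%:R * (lg2 * delta * q ^+ K.-1 * lf0)) * N.
  rewrite -mulrN -mulrA ler_wpM2l ?(ltW eta_gt0)// -dotpNr.
  rewrite (le_trans (dotp_le _ _))// l2normN ler_wpM2r//.
  apply: le_trans (ler_l2norm_sum _ _ _) _.
  have -> : K%:R * (lg2 * delta * q ^+ K.-1 * lf0) =
      \sum_(0 <= k < K) (lg2 * delta * q ^+ K.-1 * lf0).
    by rewrite sumr_const_nat subn0 -[RHS]mulr_natl.
  rewrite big_nat_cond [leRHS]big_nat_cond; apply: ler_sum => k /andP[/andP[_ kK] _].
  apply: le_trans (cross_hessian_lip _ _ _ Xl Xl) _.
  rewrite opp_col_mx add_col_mx subrr l2norm_col_mx_r.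
  rewrite (predn_split kK).
  have -> : lg2 * delta * q ^+ (k + (K - k.+1)) * lf0 =
      lg2 * (q ^+ k * delta) * (q ^+ (K - k.+1) * lf0) by rewrite exprD; ring.
  by apply: ler_pM; rewrite ?mulr_ge0 ?l2norm_ge0 ?ler_wpM2l.
(* The cross derivative itself is bounded only against differences of points of X, so the sign is
   absorbed by exchanging y and y'. *)
have h3 : - dotp (dglb (zh l) *m S) (y - y') <= lg1 * (mu^-1 *
    (lf1 * (q ^+ K * delta) + q ^+ K * lf0 +
    K%:R * eta * (lg2 * delta) * q ^+ K.-1 * lf0)) * N.
  rewrite -dotpNr opprB (le_trans (cross_hessian_bound _ _ Xl Xy' Xy))//.
  by rewrite [l2norm (y' - y)]l2normBC ler_wpM2r// ler_wpM2l// ltW.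
apply: le_trans (lerD (lerD h1 h2) h3) _; rewrite /hypergrad_err -/q /kappa -/N.
by rewrite le_eqVlt; apply/orP; left; apply/eqP; ring.
Qed.

End BilevelRound.

(** * Lower bound of a convex function *)

Section ConvexLowerBound.
Variables (R : realType) (n : nat).
Implicit Types (X : set 'cV[R]_n).

Lemma convex_set_sum X k (x : 'I_k -> 'cV[R]_n) (a : 'I_k -> R) x0 :
  convex_set X -> X x0 -> (forall i, X (x i)) -> (forall i, 0 <= a i) ->
  \sum_i a i <= 1 -> X (x0 + \sum_i a i *: (x i - x0)).
Proof.
move=> cX Xx0; elim: k x a => [|k IH] x a Xx a0 a1.
  by rewrite big_ord0 addr0.
rewrite big_ord_recr /= in a1; rewrite big_ord_recr /=.
set S := \sum_(i < k) a _ in a1; set am := a ord_max in a1 *.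
have S0 : 0 <= S by exact: sumr_ge0.
have am0 : 0 <= am by exact: a0.
(* If the last weight is 1 all others vanish, and they could not be renormalized by 1 - am. *)
have [am1|am1] := eqVneq am 1.
  have aw i : a (widen_ord (leqnSn k) i) = 0.
    have : S = 0 by apply/eqP; rewrite eq_le S0 andbT; lra.
    by move/psumr_eq0P => -> //.
  rewrite big1 ?add0r => [|i _]; last by rewrite aw scale0r.
  by rewrite am1 scale1r addrC subrK.
have am_lt1 : 0 < 1 - am by rewrite subr_gt0 lt_neqAle am1 /=; lra.
have Xy := IH (fun i => x (widen_ord (leqnSn k) i))
  (fun i => (1 - am)^-1 * a (widen_ord (leqnSn k) i)) (fun i => Xx _) _ _.
have -> : x0 + (\sum_(i < k) a (widen_ord (leqnSn k) i) *:
      (x (widen_ord (leqnSn k) i) - x0) + am *: (x ord_max - x0)) =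
    am *: x ord_max + (1 - am) *: (x0 + \sum_(i < k)
      ((1 - am)^-1 * a (widen_ord (leqnSn k) i)) *:
      (x (widen_ord (leqnSn k) i) - x0)).
  rewrite [(1 - am) *: (_ + _)]scalerDr scaler_sumr.
  under [in RHS]eq_bigr do rewrite scalerA mulrA divff ?gt_eqF// mul1r.
  by rewrite scalerBl scalerBr scale1r; apply/colP => i; rewrite !mxE; ring.
apply: convex_set_segment => //; last by rewrite am0; lra.
apply: Xy => [i|]; first by rewrite mulr_ge0 ?invr_ge0 ?(ltW am_lt1).
by rewrite -mulr_sumr ler_pdivrMl// mulr1 -/S; lra.
Qed.

(** A family of maximal rank: appending y cannot raise the rank, so y - x0 is already in the row
    space. *)
Lemma spanning_family X x0 : exists k (x : 'I_k -> 'cV[R]_n),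
  (forall i, X (x i)) /\
  forall y, X y -> ((y - x0)^T <= \matrix_i (x i - x0)^T)%MS.
Proof.
pose P r := `[< exists k (x : 'I_k -> 'cV[R]_n), (forall i, X (x i)) /\
  \rank (\matrix_i (x i - x0)^T) = r >].
have exP : exists r, P r.
  exists 0%N; apply/asboolP; exists 0%N, (fun=> 0); split; first by case.
  by apply/eqP; rewrite -leqn0 rank_leq_row.
have ubP r : P r -> (r <= n)%N.
  by move=> /asboolP[k [x [_ <-]]]; exact: rank_leq_col.
have [r /asboolP[k [x [Xx rkE]]] rmax] := ex_maxnP exP ubP.
exists k, x; split=> // y Xy; set A := \matrix_i _ in rkE *.
pose x' (i : 'I_(k + 1)) := if fintype.split i is inl j then x j else y.
have Xx' i : X (x' i) by rewrite /x'; case: fintype.split.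
have A'E : \matrix_i (x' i - x0)^T = col_mx A (y - x0)^T.
  apply/row_matrixP => i; rewrite rowK /x'.
  case: (split_ordP i) => j ->.
    by rewrite rowKu rowK.
  by rewrite rowKd row_id.
have : P (\rank (col_mx A (y - x0)^T)).
  by apply/asboolP; exists (k + 1)%N, x'; rewrite A'E.
move=> /rmax; rewrite -rkE => rk_le.
have sub : (A <= col_mx A (y - x0)^T)%MS by rewrite -addsmxE addsmxSl.
have := rk_le; rewrite (geq_leqif (mxrank_leqif_sup sub)) col_mx_sub.
by case/andP.
Qed.

(* The barycenter of a maximal simplex in X is relatively interior: the segment
   from any point of X to it can be prolonged by a fixed ratio within the
   simplex, where h is at most its maximum at the vertices. *)
Lemma convex_function_lower_bound X (h : 'cV[R]_n -> R) d :
  convex_set X -> (forall x y, X x -> X y -> l2norm (x - y) <= d) ->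
  convex_function X h -> exists m, forall x, X x -> m <= h x.
Proof.
move=> cX Xd ch.
have [X0|/set0P[x0 Xx0]] := eqVneq X set0; first by exists 0 => x; rewrite X0.
have d0 : 0 <= d by rewrite (le_trans _ (Xd _ _ Xx0 Xx0))// l2norm_ge0.
have [k [x [Xx spanX]]] := spanning_family X x0.
set A := \matrix_i (x i - x0)^T in spanX.
pose M0 := \sum_i \sum_j `|pinvmx A i j|.
pose coords y i := ((y - x0)^T *m pinvmx A) 0 i.
have coordsE y : X y -> y - x0 = \sum_i coords y i *: (x i - x0).
  move=> Xy; apply: trmx_inj; rewrite -(mulmxKpV (spanX y Xy)) mulmx_sum_row.
  by rewrite linear_sum; apply: eq_bigr => i _; rewrite linearZ /= rowK.
have coords_le y i : X y -> `|coords y i| <= d * M0.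
  move=> Xy; rewrite /coords mxE (le_trans (ler_norm_sum _ _ _))//.
  rewrite /M0 mulr_sumr; apply: ler_sum => j _; rewrite normrM mxE.
  apply: ler_pM => //; first by rewrite (le_trans (normr_coord_le _ _))// Xd.
  by rewrite (bigD1 i)//= lerDl sumr_ge0.
have M00 : 0 <= M0 by apply: sumr_ge0 => i _; exact: sumr_ge0.
pose w : R := k.+1%:R^-1; have w0 : 0 < w by rewrite invr_gt0.
(* With |coords| <= d M0, the prolonged weights w - e (coords - w) lie between 0 and w + w^2; as k w
   = 1 - w, their sum is at most 1 - w^2. *)
pose e := w ^+ 2 / (d * M0 + 1).
have dM0 : 0 <= d * M0 by rewrite mulr_ge0.
have e0 : 0 < e by rewrite divr_gt0 ?exprn_gt0//; lra.
have eM : e * (d * M0 + 1) = w ^+ 2 by rewrite /e divfK//; lra.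
have kw : k%:R * w = 1 - w by rewrite /w -natr1; field; rewrite natr1.
pose c := x0 + \sum_i w *: (x i - x0).
pose Mx := `|h x0| + \sum_i `|h (x i)|.
(* This sublevel set is convex and contains the vertices, so [convex_set_sum] yields membership in X
   and the bound on h at once. *)
pose S := [set z | X z /\ h z <= Mx].
have cS : convex_set S.
  move=> y z t; rewrite !inE => -[Xy hy] [Xz hz]; split.
    by have := cX y z t; rewrite !inE; exact.
  have t0 : 0 <= t%:inum :> R by [].
  have t1 : t%:inum <= 1 :> R by [].
  have := @convex_function_segment _ _ X h y z t%:inum ch Xy Xz; rewrite t0 t1.
  move=> /(_ isT)/le_trans; apply; move: (t%:inum) t0 t1 => s s0 s1; nra.
have Sx0 : S x0.
  by split=> //; rewrite (le_trans (ler_norm _))// lerDl sumr_ge0.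
have Sx i : S (x i).
  split=> //; rewrite (le_trans (ler_norm _))// /Mx (bigD1 i)//= addrCA lerDl.
  by rewrite addr_ge0// sumr_ge0.
have w1 : w <= 1 by rewrite invf_le1// ler1n.
have Sc : S c.
  apply: convex_set_sum => // [i|]; first exact: ltW.
  by rewrite sumr_const card_ord -[X in X <= _]mulr_natl kw; lra.
exists (((1 + e) * h c - Mx) / e) => y Xy; rewrite ler_pdivrMr//.
pose c' := c - e *: (y - c).
have [Xc' hc'] : S c'.
  have -> : c' = x0 + \sum_i (w - e * (coords y i - w)) *: (x i - x0).
    rewrite /c'; have -> : y - c = \sum_i coords y i *: (x i - x0) - \sum_i w *: (x i - x0).
      by rewrite -coordsE// /c opprD addrA.
    rewrite -sumrB scaler_sumr /c -addrA -sumrB; congr (_ + _).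
    by apply: eq_bigr => i _; rewrite -scalerBl scalerA -scalerBl.
  apply: convex_set_sum => // [i|].
    by have := coords_le y i Xy => /ler_normlP[]; nra.
  apply: (@le_trans _ _ (\sum_(i < k) (w + w ^+ 2))).
    by apply: ler_sum => i _; have := coords_le y i Xy => /ler_normlP[]; nra.
  by rewrite sumr_const card_ord -[X in X <= _]mulr_natl mulrDr expr2 mulrA kw; nra.
have e1 : 1 + e != 0 by lra.
have cE : c = (1 + e)^-1 *: c' + (1 - (1 + e)^-1) *: y.
  by apply/colP => i; rewrite /c' !mxE; field.
have := @convex_function_segment _ _ X h c' y (1 + e)^-1 ch Xc' Xy.
rewrite -cE invr_ge0 invf_le1; last by lra.
have e1' : 0 <= 1 + e by lra.
have le1e : 1 <= 1 + e by lra.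
rewrite e1' le1e => /(_ isT) hc.
have : (1 + e) * h c <= h c' + e * h y.
  have -> : h c' + e * h y = (1 + e) * ((1 + e)^-1 * h c' + (1 - (1 + e)^-1) * h y).
    by field.
  by rewrite ler_wpM2l.
lra.
Qed.
End ConvexLowerBound.

(** * Bregman steps and window averages *)

Section BregmanProx.
Variables (R : realType) (n : nat) (X : set 'cV[R]_n) (h phi : 'cV[R]_n -> R).
Variables (dphi : 'cV[R]_n -> 'cV[R]_n) (rho alpha : R).
Hypotheses (X_convex : convex_set X) (h_convex : convex_function X h).
Hypothesis phi_sc : strongly_convex_on X rho phi.
Hypotheses (rho_gt0 : 0 < rho) (alpha_gt0 : 0 < alpha).
Implicit Types (u q x y l : 'cV[R]_n).

Let obj := prox_obj h phi dphi alpha.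

Lemma prox_obj_strongly_convex u q : strongly_convex_on X (rho / alpha) (obj u q).
Proof.
move=> x y s Xx Xy s01; rewrite /obj /prox_obj /bregman.
have := convex_function_segment h_convex Xx Xy s01.
have := phi_sc Xx Xy s01; set z := s *: x + _ => h1 h2.
have a0 : 0 < alpha^-1 by rewrite invr_gt0.
have := ler_wpM2l (ltW a0) h1.
have -> : dotp (dphi u) (z - u) =
    s * dotp (dphi u) (x - u) + (1 - s) * dotp (dphi u) (y - u).
  by rewrite !dotpBr /z dotpDr !dotpZr; ring.
have -> : dotp q z = s * dotp q x + (1 - s) * dotp q y.
  by rewrite /z dotpDr !dotpZr.
by lra.
Qed.

Lemma prox_growth u q l y : is_argmin X (obj u q) l -> X y ->
  obj u q l + rho / alpha / 2 * l2norm (y - l) ^+ 2 <= obj u q y.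
Proof.
move=> lmin Xy; apply: (@strongly_convex_growth _ _ X) => //.
- by move=> s /andP[s0 s1]; apply: convex_set_segment => //; [exact: lmin.1 | rewrite (ltW s0)].
- by rewrite divr_ge0 ?ltW.
- exact: prox_obj_strongly_convex.
Qed.

(** Two halves of rho/alpha add up: one from the quadratic growth of the objective at l, tested at
    u, the other from the Bregman distance of l to u. *)
Lemma prox_descent u q l : X u -> is_grad_on X phi u (dphi u) ->
  is_argmin X (obj u q) l ->
  rho / alpha * l2norm (u - l) ^+ 2 <= dotp q (u - l) + (h u - h l).
Proof.
move=> Xu gradu lmin; have := prox_growth lmin Xu; have [Xl _] := lmin.
have seg s : 0 < s <= 1 -> X (s *: l + (1 - s) *: u).
  by move=> /andP[s0 s1]; apply: convex_set_segment => //; rewrite (ltW s0).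
have := strongly_convex_grad seg (ltW rho_gt0) phi_sc Xu Xl gradu.
rewrite /obj /prox_obj /bregman !subrr dotp0r subr0 mulr0 addr0 [dotp q (u - l)]dotpBr.
rewrite [l2norm (l - u)]l2normBC => h1 h2.
have : alpha^-1 * (rho / 2 * l2norm (u - l) ^+ 2) <=
    alpha^-1 * (phi l - phi u - dotp (dphi u) (l - u)).
  by rewrite ler_wpM2l ?invr_ge0 ?(ltW alpha_gt0)//; lra.
lra.
Qed.

(** Each minimizer is tested in the growth inequality of the other; in the sum only <q1 - q2, l2 -
    l1> survives, so the error is needed against a difference of points of X only. *)
Lemma prox_dist u q1 q2 l1 l2 E : 0 <= E ->
  is_argmin X (obj u q1) l1 -> is_argmin X (obj u q2) l2 ->
  dotp (q1 - q2) (l2 - l1) <= E * l2norm (l2 - l1) ->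
  l2norm (l2 - l1) <= alpha / rho * E.
Proof.
move=> E0 l1min l2min qE.
have := prox_growth l1min l2min.1; have := prox_growth l2min l1min.1.
rewrite [l2norm (l1 - l2)]l2normBC /obj /prox_obj => h1 h2.
have h3 : rho / alpha * l2norm (l2 - l1) ^+ 2 <= E * l2norm (l2 - l1).
  by move: qE; rewrite !(dotpBl, dotpBr); lra.
have r0 : 0 < rho / alpha by rewrite divr_gt0.
rewrite -[alpha / rho]invf_div ler_pdivlMl//.
have [->|N0] := eqVneq (l2norm (l2 - l1)) 0; first by rewrite mulr0.
by move: h3; rewrite expr2 mulrA ler_pM2r// lt_neqAle eq_sym N0 l2norm_ge0.
Qed.

Lemma gen_proj_le u q qh lh E : 0 <= E -> X u ->
  is_argmin X (obj u qh) lh ->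
  (forall y y', X y -> X y' -> dotp (qh - q) (y - y') <= E * l2norm (y - y')) ->
  l2norm (gen_proj X h phi dphi alpha u q) ^+ 2 <=
    2 / alpha ^+ 2 * l2norm (u - lh) ^+ 2 + 2 / rho ^+ 2 * E ^+ 2.
Proof.
move=> E0 Xu lhmin qE.
have rhs0 : 0 <= 2 / alpha ^+ 2 * l2norm (u - lh) ^+ 2 + 2 / rho ^+ 2 * E ^+ 2.
  by rewrite addr_ge0// mulr_ge0 ?divr_ge0 ?sqr_ge0.
rewrite /gen_proj; set l := bregman_step _ _ _ _ _ _ _.
(* Without a minimizer the step keeps its default value u, and the generalized projection is 0. *)
have [[l' l'min]|nomin] := pselect (exists l', is_argmin X (obj u q) l'); last first.
  rewrite (_ : l = u) ?subrr ?scaler0 ?l2norm0 ?expr0n//.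
  by rewrite /l /bregman_step xgetPN// => l' l'min; apply: nomin; exists l'.
have lmin : is_argmin X (obj u q) l.
  by apply: (@xgetPex _ _ [set l | is_argmin X (obj u q) l]); exists l'.
have h1 := prox_dist E0 lhmin lmin (qE _ _ lmin.1 lhmin.1).
have h2 : l2norm (u - l) <= l2norm (u - lh) + alpha / rho * E.
  have -> : u - l = (u - lh) - (l - lh) by rewrite opprB addrA subrK.
  by rewrite (le_trans (ler_l2normB _ _))// lerD2l.
rewrite l2normZ gtr0_norm ?invr_gt0// exprMn exprVn.
set a := l2norm (u - lh) in h2 *; set b := alpha / rho * E in h2.
have bE : b ^+ 2 = alpha ^+ 2 * (E ^+ 2 / rho ^+ 2) by rewrite /b; field; rewrite gt_eqF.
have : l2norm (u - l) ^+ 2 <= 2 * a ^+ 2 + 2 * b ^+ 2.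
  have a0 : 0 <= a by exact: l2norm_ge0.
  have b0 : 0 <= b by rewrite mulr_ge0// divr_ge0 ?ltW.
  apply: (@le_trans _ _ ((a + b) ^+ 2)); first by rewrite ler_pXn2r ?nnegrE ?addr_ge0 ?l2norm_ge0.
  by have := sqr_ge0 (a - b); lra.
move=> h3; rewrite -[leRHS](mulKf (x := alpha ^+ 2)) ?expf_neq0 ?gt_eqF//.
rewrite ler_wpM2l ?invr_ge0 ?sqr_ge0//.
have -> : alpha ^+ 2 * (2 / alpha ^+ 2 * a ^+ 2 + 2 / rho ^+ 2 * E ^+ 2) =
  2 * a ^+ 2 + 2 * b ^+ 2 by rewrite bE; field; rewrite !gt_eqF.
exact: h3.
Qed.

End BregmanProx.

Section WindowSums.
Variable R : realType.

(** Substitution s = t - i; the constraint t <= T becomes s < T + 1 - i. *)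
Lemma window_sum_reindex (V : nmodType) (F : nat -> nat -> V) T w :
  \sum_(1 <= t < T.+1) \sum_(i < w | (i < t)%N) F (t - i)%N i =
  \sum_(1 <= s < T.+1) \sum_(i < w | (s < T.+1 - i)%N) F s i.
Proof.
rewrite (exchange_big_dep xpredT)//= [RHS](exchange_big_dep xpredT)//=.
apply: eq_bigr => i _.
rewrite -(big_nat_widenl i.+1 1 T.+1 xpredT (fun t => F (t - i)%N i))//.
rewrite -[i.+1]add1n big_addn.
rewrite (big_nat_widen 1 (T.+1 - i) T.+1) ?leq_subr//.
by apply: eq_bigr => s _; rewrite addnK.
Qed.

Lemma dotp_window_avg n w (a : nat -> 'cV[R]_n) t v :
  dotp (window_avg w a t) v =
  w%:R^-1 * \sum_(i < w | (i < t)%N) dotp (a (t - i)%N) v.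
Proof. by rewrite /window_avg dotpZl dotp_suml. Qed.

Lemma sum_sqr_le k (a : 'I_k -> R) :
  (\sum_i a i) ^+ 2 <= k%:R * \sum_i a i ^+ 2.
Proof.
have := @normr_dotp_le _ _ (const_mx 1 : 'cV[R]_k) (\col_i a i).
rewrite -(@ler_pXn2r _ 2) ?nnegrE ?mulr_ge0 ?l2norm_ge0//.
rewrite exprMn !l2norm_sqr real_normK ?num_real// /dotp.
under eq_bigr do rewrite !mxE mul1r.
under [X in _ <= X * _]eq_bigr do rewrite mxE mulr1.
under [X in _ <= _ * X]eq_bigr do rewrite !mxE -expr2.
by rewrite sumr_const card_ord.
Qed.

Definition window_mean w (E : nat -> R) t :=
  w%:R^-1 * \sum_(i < w | (i < t)%N) E (t - i)%N.

(** Jensen's inequality inside each window; each E(s)^2 then occurs in at most w windows with weight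
    1/w. *)
Lemma sum_window_mean_sqr_le w (E : nat -> R) T : (0 < w)%N ->
  \sum_(1 <= t < T.+1) window_mean w E t ^+ 2 <= \sum_(1 <= t < T.+1) E t ^+ 2.
Proof.
move=> w0; have wR : 0 < w%:R :> R by rewrite ltr0n.
apply: (@le_trans _ _ (\sum_(1 <= t < T.+1)
    \sum_(i < w | (i < t)%N) w%:R^-1 * E (t - i)%N ^+ 2)).
  apply: ler_sum => t _; rewrite /window_mean exprMn -mulr_sumr.
  rewrite big_mkcond /= [in leRHS]big_mkcond /=.
  apply: le_trans (ler_wpM2l _ (sum_sqr_le _)) _; first by rewrite sqr_ge0.
  rewrite exprVn expr2 invfM -!mulrA mulKf ?gt_eqF// ler_wpM2l ?invr_ge0 ?(ltW wR)//.
  by apply: ler_sum => i _; case: ifP => // _; rewrite expr0n.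
rewrite (window_sum_reindex (fun s i => w%:R^-1 * E s ^+ 2)).
apply: ler_sum => s _; rewrite big_mkcond /=.
apply: (@le_trans _ _ (\sum_(i < w) w%:R^-1 * E s ^+ 2)).
  by apply: ler_sum => i _; case: ifP => // _; rewrite mulr_ge0 ?invr_ge0 ?sqr_ge0 ?ler0n.
by rewrite sumr_const card_ord -[X in X <= _]mulr_natl mulVKf ?gt_eqF.
Qed.

(* Exchanging the sums pairs each [p s] with the telescoping displacement of the
   iterates over the w rounds in which it is used. *)
Lemma window_displacement_le n (X : set 'cV[R]_n) (lam p : nat -> 'cV[R]_n) T w G d :
  (0 < w)%N -> 0 <= G ->
  (forall t, (1 <= t <= T.+1)%N -> X (lam t)) ->
  (forall x y, X x -> X y -> l2norm (x - y) <= d) ->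
  (forall t y y', (1 <= t <= T)%N -> X y -> X y' ->
     dotp (p t) (y - y') <= G * l2norm (y - y')) ->
  \sum_(1 <= t < T.+1) dotp (window_avg w p t) (lam t - lam t.+1) <=
    T%:R / w%:R * (G * d).
Proof.
move=> w0 G0 Xlam Xd p_le.
under eq_bigr do rewrite dotp_window_avg.
rewrite -mulr_sumr mulrAC mulrC ler_wpM2r ?invr_ge0 ?ler0n//.
have E t : \sum_(i < w | (i < t)%N) dotp (p (t - i)%N) (lam t - lam t.+1) =
    \sum_(i < w | (i < t)%N) dotp (p (t - i)%N) (lam (t - i + i)%N - lam (t - i + i).+1).
  by apply: eq_bigr => i it; rewrite subnK// ltnW.
under eq_bigr do rewrite E.
rewrite (window_sum_reindex (fun s i => dotp (p s) (lam (s + i)%N - lam (s + i).+1))).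
have -> : T%:R * (G * d) = \sum_(1 <= t < T.+1) (G * d).
  by rewrite sumr_const_nat subn1 mulr_natl.
rewrite big_nat_cond [leRHS]big_nat_cond; apply: ler_sum => s /andP[/andP[s1 sT] _].
(* Round s is used in rounds s to s + w - 1, cut off at T; the telescoped sum therefore ends at
   index T + 1 at most. *)
have -> : \sum_(i < w | (s < T.+1 - i)%N) dotp (p s) (lam (s + i)%N - lam (s + i).+1) =
    dotp (p s) (lam s - lam (s + minn w (T.+1 - s))%N).
  rewrite -dotp_sumr; congr dotp.
  rewrite -(big_mkord (fun i => s < T.+1 - i)%N (fun i => lam (s + i)%N - lam (s + i).+1)).
  have -> : \sum_(0 <= i < w | (s < T.+1 - i)%N) (lam (s + i)%N - lam (s + i).+1) =
     \sum_(0 <= i < minn w (T.+1 - s)) (lam (s + i)%N - lam (s + i).+1).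
    rewrite [RHS](big_nat_widen _ _ w) ?geq_minl//.
    rewrite [LHS]big_nat_cond [RHS]big_nat_cond; apply: eq_bigl => i /=.
    by apply: andb_id2l => iw; rewrite leq_min iw !ltn_subRL addnC.
  under eq_bigr do rewrite -opprB.
  rewrite sumrN; under eq_bigr do rewrite -addnS.
  by rewrite (telescope_sumr (fun i => lam (s + i)%N))// addn0 opprB.
have Xs : X (lam s) by apply: Xlam; rewrite s1 ltnW.
have Xs' : X (lam (s + minn w (T.+1 - s))%N).
  apply: Xlam; rewrite addn_gt0 s1 /= -leq_subRL ?geq_minr//; exact: ltnW.
by rewrite (le_trans (p_le _ _ _ _ Xs Xs')) ?s1// ler_wpM2l// Xd.
Qed.

(* Young's inequality absorbs the error term <qhat - q, lam_t - lam_(t+1)>, and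
   the window average of q is controlled by its displacement pairing. *)
Lemma prox_regret_le n (X : set 'cV[R]_n) (h : 'cV[R]_n -> R)
    (phi : nat -> 'cV[R]_n -> R) (dphi : nat -> 'cV[R]_n -> 'cV[R]_n)
    (rho alpha d G m : R) (T w : nat) (lam p ph : nat -> 'cV[R]_n) (E : nat -> R) :
  convex_set X -> convex_function X h -> 0 < rho -> 0 < alpha -> (0 < w)%N ->
  (forall x y, X x -> X y -> l2norm (x - y) <= d) ->
  (forall x, X x -> m <= h x) ->
  0 <= G -> (forall t, 0 <= E t) ->
  X (lam 1%N) ->
  (forall t, (1 <= t <= T)%N ->
    [/\ forall l, X l -> is_grad_on X (phi t) l (dphi t l),
        strongly_convex_on X rho (phi t)
      & is_argmin X (prox_obj h (phi t) (dphi t) alpha (lam t) (window_avg w ph t))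
          (lam t.+1)]) ->
  (forall t y y', (1 <= t <= T)%N -> X y -> X y' ->
     dotp (p t) (y - y') <= G * l2norm (y - y')) ->
  (forall t y y', (1 <= t <= T)%N -> X y -> X y' ->
     dotp (ph t - p t) (y - y') <= E t * l2norm (y - y')) ->
  \sum_(1 <= t < T.+1)
     l2norm (gen_proj X h (phi t) (dphi t) alpha (lam t) (window_avg w p t)) ^+ 2 <=
  4 / (alpha * rho) * (T%:R / w%:R * (G * d) + (h (lam 1%N) - m))
    + 4 / rho ^+ 2 * \sum_(1 <= t < T.+1) E t ^+ 2.
Proof.
move=> cX ch rho0 alpha0 w0 Xd hm G0 E0 X1 step p_le ph_le.
have wR : 0 < w%:R :> R by rewrite ltr0n.
have Xlam t : (1 <= t <= T.+1)%N -> X (lam t).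
  case: t => // -[_ //|t tT]; have [|_ _ []//] := step t.+1.
  by move: tT; rewrite /= ltnS => ->.
have W0 t : 0 <= window_mean w E t.
  by rewrite mulr_ge0 ?invr_ge0 ?(ltW wR)// sumr_ge0.
have W_le t y y' : (1 <= t <= T)%N -> X y -> X y' ->
    dotp (window_avg w ph t - window_avg w p t) (y - y') <=
    window_mean w E t * l2norm (y - y').
  move=> /andP[t1 tT] Xy Xy'; rewrite dotpBl !dotp_window_avg -mulrBr -sumrB.
  rewrite /window_mean -mulrA ler_wpM2l ?invr_ge0 ?(ltW wR)// mulr_suml.
  apply: ler_sum => i it; rewrite -dotpBl ph_le//.
  by rewrite subn_gt0 it /= (leq_trans (leq_subr _ _)).
set q := window_avg w p.
have round t : (1 <= t < T.+1)%N ->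
  l2norm (gen_proj X h (phi t) (dphi t) alpha (lam t) (q t)) ^+ 2 <=
  4 / (alpha * rho) * (dotp (q t) (lam t - lam t.+1) + (h (lam t) - h (lam t.+1)))
  + 4 / rho ^+ 2 * window_mean w E t ^+ 2.
  rewrite ltnS => tT; have [gradphi scphi lmin] := step t tT.
  have Xt : X (lam t) by apply: Xlam; case/andP: tT => -> /leqW.
  have Xt1 := lmin.1.
  have := gen_proj_le cX ch scphi rho0 alpha0 (W0 t) Xt lmin
    (fun y y' => @W_le t y y' tT).
  have := prox_descent cX ch scphi rho0 alpha0 Xt (gradphi _ Xt) lmin.
  have := W_le t _ _ tT Xt Xt1; rewrite dotpBl.
  set N := l2norm (lam t - lam t.+1); set W := window_mean w E t => h1 h2 /le_trans; apply.
  (* Weighted so that the N^2 term is exactly half of the left side of [prox_descent]. *)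
  have young : W * N <= rho / (2 * alpha) * N ^+ 2 + alpha / (2 * rho) * W ^+ 2.
    have -> : rho / (2 * alpha) * N ^+ 2 + alpha / (2 * rho) * W ^+ 2 =
      W * N + rho / (2 * alpha) * (N - alpha / rho * W) ^+ 2.
      by field; rewrite !gt_eqF.
    by rewrite lerDl mulr_ge0 ?sqr_ge0// divr_ge0 ?mulr_ge0 ?ltW.
  set Z := dotp (q t) _ + _.
  have h3 : rho / alpha * N ^+ 2 <= Z + rho / (2 * alpha) * N ^+ 2 + alpha / (2 * rho) * W ^+ 2.
    by rewrite /Z; lra.
  (* This factor turns the left side into 4/alpha^2 N^2: half absorbs the Young term, half pays for
     the displacement in [gen_proj_le]. The two errors 2/rho^2 W^2 add up to 4/rho^2 W^2. *)
  have c0 : 0 < 4 / (alpha * rho) by rewrite divr_gt0 ?mulr_gt0.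
  have := ler_wpM2l (ltW c0) h3.
  have -> : 4 / (alpha * rho) * (rho / alpha * N ^+ 2) = 4 / alpha ^+ 2 * N ^+ 2.
    by field; rewrite !gt_eqF.
  have -> : 4 / (alpha * rho) * (Z + rho / (2 * alpha) * N ^+ 2 + alpha / (2 * rho) * W ^+ 2) =
     4 / (alpha * rho) * Z + 2 / alpha ^+ 2 * N ^+ 2 + 2 / rho ^+ 2 * W ^+ 2.
    by field; rewrite !gt_eqF.
  by rewrite (_ : 4 / alpha ^+ 2 * N ^+ 2 = 2 / alpha ^+ 2 * N ^+ 2 *+ 2); [lra|ring].
apply: le_trans (ler_sum_nat round) _.
rewrite big_split /= -!mulr_sumr big_split /=; apply: lerD.
  rewrite ler_wpM2l ?divr_ge0 ?mulr_ge0 ?(ltW alpha0) ?(ltW rho0)//; apply: lerD.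
    exact: (window_displacement_le w0 G0 Xlam Xd p_le).
  under eq_bigr do rewrite -opprB.
  rewrite sumrN (telescope_sumr (fun t => h (lam t)))// opprB lerD2l lerN2.
  by apply/hm/Xlam; rewrite /= leqnn.
by rewrite ler_wpM2l ?divr_ge0 ?sqr_ge0// sum_window_mean_sqr_le.
Qed.

End WindowSums.

(** * Numerical sequences *)

Section Rates.
Variable R : realType.

(** A set without a supremum has [sup] equal to 0, so the sign of the variation measures needs no
    finiteness. *)
Lemma sup_nonneg (A : set R) : (forall x, A x -> 0 <= x) -> 0 <= sup A.
Proof.
move=> A0; have [supA|/sup_out -> //] := pselect (has_sup A).
by have [x Ax] := supA.1; rewrite (le_trans (A0 _ Ax))// ub_le_sup//; exact: supA.2.
Qed.

(** 1 - (1 - s)^(n+1) is s times a geometric sum of n + 1 terms, each at least (1 - s)^n. *)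
Lemma natmul_geometric_le1 (s : R) n : 0 <= s <= 1 ->
  n.+1%:R * s * (1 - s) ^+ n <= 1.
Proof.
move=> /andP[s0 s1]; have q0 : 0 <= 1 - s by lra.
suff : n.+1%:R * s * (1 - s) ^+ n <= 1 - (1 - s) ^+ n.+1.
  by move/le_trans; apply; rewrite gerBl exprn_ge0.
elim: n => [|n IH]; first by rewrite expr0 expr1; lra.
have qn : (1 - s) ^+ n.+1 <= 1 by rewrite exprn_ile1//; lra.
have := ler_wpM2l q0 IH; have := ler_wpM2l s0 qn.
by rewrite -[n.+2%:R]natr1 !exprS; lra.
Qed.

(** Removes the factor K ~ log T with a constant free of s: for m = n/2 rounded down, n + 1 <= 2 (m
    + 1), and the previous bound at m uses up one of the two powers (1 - s)^n. *)
Lemma natmul_geometric_sqr_le (s : R) n : 0 <= s <= 1 ->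
  (n.+1%:R * s * (1 - s) ^+ n) ^+ 2 <= 4 * (1 - s) ^+ n.
Proof.
move=> s01; have /andP[s0 s1] := s01; have q0 : 0 <= 1 - s by lra.
have q1 : 1 - s <= 1 by lra.
set m := n./2.
have nm : (n.+1 <= 2 * m.+1)%N.
  by rewrite mul2n doubleS ltnS -[in leqLHS](odd_double_half n) -add1n leq_add2r leq_b1.
have mn : (m + m <= n)%N by rewrite addnn -[leqRHS](odd_double_half n) leq_addl.
have h1 := natmul_geometric_le1 m s01.
have h0 : 0 <= m.+1%:R * s * (1 - s) ^+ m by rewrite !mulr_ge0 ?exprn_ge0.
have h2 : (n.+1%:R * s) ^+ 2 * (1 - s) ^+ n <=
    (2 * m.+1%:R * s) ^+ 2 * (1 - s) ^+ (m + m).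
  have ha : (n.+1%:R * s) ^+ 2 <= (2 * m.+1%:R * s) ^+ 2.
    by rewrite ler_pXn2r ?nnegrE ?mulr_ge0// ler_wpM2r// -natrM ler_nat.
  have hb : (1 - s) ^+ n <= (1 - s) ^+ (m + m) by rewrite ler_wiXn2l.
  exact: ler_pM (sqr_ge0 _) (exprn_ge0 _ q0) ha hb.
have h3 : (2 * m.+1%:R * s) ^+ 2 * (1 - s) ^+ (m + m) <= 4.
  have -> : (2 * m.+1%:R * s) ^+ 2 * (1 - s) ^+ (m + m) =
    4 * (m.+1%:R * s * (1 - s) ^+ m) ^+ 2 by rewrite exprD; ring.
  by rewrite -[leRHS]mulr1 ler_wpM2l// exprn_ile1.
rewrite exprMn [(1 - s) ^+ n ^+ 2]expr2 mulrA ler_wpM2r ?exprn_ge0//.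
exact: le_trans h2 h3.
Qed.

Lemma inner_steps_geometric (x : R) T K : 0 < x < 1 -> (0 < T)%N ->
  K%:Z = Num.ceil (ln T%:R / ln x^-1) + 1 -> x ^+ K.-1 <= T%:R^-1.
Proof.
move=> /andP[x0 x1] T0 KE; have TR : 0 < T%:R :> R by rewrite ltr0n.
have lnx : 0 < ln x^-1 by rewrite ln_gt0// invf_gt1.
have c0 : 0 <= ln T%:R / ln x^-1.
  by apply: divr_ge0; [rewrite ln_ge0 ?ler1n | exact: ltW].
have KR : ln T%:R / ln x^-1 <= K.-1%:R.
  (* As T >= 1 the ceiling is nonnegative, hence K >= 1 and the predecessor is not truncated. *)
  have K1 : (K.-1)%:Z = Num.ceil (ln T%:R / ln x^-1).
    have : 0 <= Num.ceil (ln T%:R / ln x^-1) by rewrite ceil_ge0 (lt_le_trans _ c0)// ltrN10.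
    lia.
  by rewrite -[K.-1%:R]/((K.-1)%:Z%:~R) K1 Num.Theory.ceil_ge.
rewrite -[leLHS]invrK lef_pV2 ?posrE ?invr_gt0 ?exprn_gt0// -exprVn.
rewrite -ler_ln ?posrE ?exprn_gt0 ?invr_gt0// lnXn ?invr_gt0//.
by rewrite -[_ *+ K.-1]mulr_natl -ler_pdivrMr.
Qed.

Lemma halving_recurrence_sum (D H : nat -> R) (b c : R) T : (0 < T)%N ->
  D 1%N <= b ->
  (forall t, (1 <= t < T)%N -> D t.+1 <= D t / 2 + c + H t.+1) ->
  (forall t, 0 <= D t) -> 0 <= c ->
  \sum_(1 <= t < T.+1) D t <= 2 * b + 2 * (T%:R * c + \sum_(2 <= t < T.+1) H t).
Proof.
move=> T0 D1 Drec D0 c0.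
(* The extra D T makes the induction close: the new term counts twice, and twice D T / 2 is what the
   previous bound supplies. *)
suff : \sum_(1 <= t < T.+1) D t + D T <=
    2 * b + 2 * (T%:R * c + \sum_(2 <= t < T.+1) H t) by have := D0 T; lra.
elim: T T0 Drec => // -[_ _ _|T IH _ Drec].
  by rewrite big_nat1 big_geq//; lra.
have Drec' t : (1 <= t < T.+1)%N -> D t.+1 <= D t / 2 + c + H t.+1.
  by move=> /andP[t1 tT]; apply: Drec; rewrite t1 leqW.
have h2 := IH isT Drec'; have := Drec T.+1.
rewrite ltnSn => /(_ isT) h1.
rewrite big_nat_recr//= [in leRHS]big_nat_recr//= -[T.+2%:R]natr1.
lra.
Qed.

End Rates.

(** * Tracking and hypergradient errors along a run *)

(** The weights 2, 4, 4 favour a: with a <= delta/2 its share is delta^2/2, which keeps the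
    recurrence contracting. *)
Lemma sqr_le_of_triple (R : realType) (a b c d : R) : 0 <= d -> d <= a + b + c ->
  d ^+ 2 <= 2 * a ^+ 2 + 4 * b ^+ 2 + 4 * c ^+ 2.
Proof.
move=> d0 dabc; apply: (@le_trans _ _ ((a + b + c) ^+ 2)).
  by rewrite ler_pXn2r ?nnegrE// (le_trans d0).
have := sqr_ge0 (a - (b + c)); have := sqr_ge0 (b - c); lra.
Qed.

Section OBBORun.
Variables (R : realType) (d1 d2 : nat) (X : set 'cV[R]_d1) (h : 'cV[R]_d1 -> R).
Variables (lf0 lf1 lg1 lg2 mu eta alpha diam : R) (T w K : nat).
Variables (f g : nat -> 'cV[R]_(d1 + d2) -> R).
Variables (df dg : nat -> 'cV[R]_(d1 + d2) -> 'cV[R]_(d1 + d2)).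
Variables (dglb : nat -> 'cV[R]_(d1 + d2) -> 'M[R]_(d1, d2)).
Variables (dgbb : nat -> 'cV[R]_(d1 + d2) -> 'M[R]_d2).
Variables (phi : nat -> 'cV[R]_d1 -> R) (dphi : nat -> 'cV[R]_d1 -> 'cV[R]_d1).
Variables (lam : nat -> 'cV[R]_d1) (beta : nat -> 'cV[R]_d2).
Hypothesis X_diam : forall l l', X l -> X l' -> l2norm (l - l') <= diam.
Hypotheses (lf0_ge0 : 0 <= lf0) (lf1_ge0 : 0 <= lf1) (lg2_ge0 : 0 <= lg2).
Hypotheses (lg1_gt0 : 0 < lg1) (mu_gt0 : 0 < mu) (eta_gt0 : 0 < eta).
Hypotheses (eta_lg1 : eta * lg1 <= 1) (eta_mu : eta * mu < 1).
Hypothesis T_gt0 : (0 < T)%N.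
Hypothesis reg : forall t, (1 <= t <= T.+1)%N ->
  [/\ outer_regular X lf0 lf1 (f t) (df t),
      inner_regular X lg1 lg2 (g t) (dg t) (dglb t) (dgbb t)
    & forall l, X l -> strongly_convex_on setT mu (fun b => g t (col_mx l b))].
Hypothesis run : obbo X h phi dphi df dg dglb dgbb eta alpha T w K lam beta.
Hypothesis K_large : (1 - eta * mu) ^+ K.-1 <= T%:R^-1.

Let kap := kappa lg1 mu.
Let delta t := l2norm (beta t - beta_hat (g t) (lam t)).
Let q := 1 - eta * mu.

Let kap_ge0 : 0 <= kap. Proof. by rewrite divr_ge0 ?ltW. Qed.
Let q_gt0 : 0 < q. Proof. by rewrite subr_gt0. Qed.
Let q_le1 : q <= 1. Proof. by rewrite gerBl mulr_ge0 ?ltW. Qed.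

Lemma obbo_mem t : (1 <= t <= T.+1)%N -> X (lam t).
Proof.
have [X1 step] := run; case: t => [//|[//|t]] /andP[_ tT].
by have [|_ []] := step t.+1.
Qed.

Let qK : q ^+ K <= T%:R^-1.
Proof.
by apply: le_trans K_large; rewrite ler_wiXn2l ?(ltW q_gt0)// leq_pred.
Qed.

(** A is the inner error left after K steps, B the motion of the minimizer with lambda, bounded
    through the diameter, and C the change of the inner objective, which feeds H_{2,T}. *)
Lemma tracking_error_step t : (1 <= t < T)%N ->
  delta t.+1 ^+ 2 <= delta t ^+ 2 / 2 + 4 * kap ^+ 2 * diam ^+ 2
    + 4 * kap ^+ 2 * sup [set l2norm (beta_hat (g t) l - beta_hat (g t.+1) l) ^+ 2 | l in X].
Proof.
move=> /andP[t1 tT].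
have tT1 : (1 <= t <= T.+1)%N by rewrite t1 ltnW// ltnW.
have tT1' : (1 <= t.+1 <= T.+1)%N by rewrite /= ltnS ltnW.
have [_ g_reg g_sc] := reg tT1; have [_ g_reg' g_sc'] := reg tT1'.
have Xt := obbo_mem tT1; have Xt' := obbo_mem tT1'.
have tT0 : (1 <= t <= T)%N by rewrite t1 ltnW.
have [betaE _] := run.2 t tT0.
set s := sup _.
pose A := l2norm (beta t.+1 - beta_hat (g t) (lam t)).
pose B := l2norm (beta_hat (g t) (lam t) - beta_hat (g t) (lam t.+1)).
pose C := l2norm (beta_hat (g t) (lam t.+1) - beta_hat (g t.+1) (lam t.+1)).
have tri : delta t.+1 <= A + B + C.
  rewrite /delta -(subrKA (beta_hat (g t) (lam t.+1))) (le_trans (ler_l2normD _ _))//.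
  rewrite lerD2r -(subrKA (beta_hat (g t) (lam t))); exact: ler_l2normD.
(* The contraction q^K is at most 1/T, and t < T forces T >= 2. *)
have A_le : A <= delta t / 2.
  rewrite /A betaE.
  apply: le_trans (inner_iter_dist g_reg g_sc lg1_gt0 mu_gt0 eta_gt0 eta_lg1 eta_mu _ _ Xt) _.
  rewrite mulrC ler_wpM2l ?l2norm_ge0// (le_trans qK)// lef_pV2 ?posrE ?ltr0n//.
  by rewrite ler_nat (leq_ltn_trans t1).
have B_le : B <= kap * diam.
  apply: le_trans (beta_hat_lip g_reg g_sc lg1_gt0 mu_gt0 eta_gt0 eta_lg1 eta_mu Xt Xt') _.
  by rewrite ler_wpM2l// X_diam.
have d0 : 0 <= diam by rewrite (le_trans (l2norm_ge0 _) (X_diam Xt Xt)).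
have kd0 : 0 <= kap * diam by exact: mulr_ge0.
have C_le : C ^+ 2 <= kap ^+ 2 * s.
  have Ck : C <= kap * C by apply: (le_kappa_l2norm g_reg g_sc mu_gt0); exists (lam t).
  have C0 : 0 <= C by exact: l2norm_ge0.
  apply: (@le_trans _ _ (kap ^+ 2 * C ^+ 2)).
    by rewrite -exprMn ler_pXn2r ?nnegrE ?(mulr_ge0 kap_ge0).
  rewrite ler_wpM2l ?sqr_ge0//; apply: ub_le_sup; last by exists (lam t.+1).
  (* The supremum is finite: both minimizer maps are [kap]-Lipschitz, so their distance at l exceeds
     C by at most 2 kap diam. *)
  exists ((C + 2 * (kap * diam)) ^+ 2) => _ [l Xl <-].
  have Ckd0 : 0 <= C + 2 * (kap * diam) by rewrite addr_ge0// mulr_ge0.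
  rewrite ler_pXn2r ?nnegrE ?l2norm_ge0//.
  have b1 := beta_hat_lip g_reg g_sc lg1_gt0 mu_gt0 eta_gt0 eta_lg1 eta_mu Xl Xt'.
  have b2 := beta_hat_lip g_reg' g_sc' lg1_gt0 mu_gt0 eta_gt0 eta_lg1 eta_mu Xt' Xl.
  have k1 := ler_wpM2l kap_ge0 (X_diam Xl Xt').
  have k2 := ler_wpM2l kap_ge0 (X_diam Xt' Xl).
  rewrite -(subrKA (beta_hat (g t) (lam t.+1))).
  rewrite -[X in _ + X](subrKA (beta_hat (g t.+1) (lam t.+1))).
  have := ler_l2normD (beta_hat (g t) (lam t.+1) - beta_hat (g t.+1) (lam t.+1))
    (beta_hat (g t.+1) (lam t.+1) - beta_hat (g t.+1) l).
  have := ler_l2normD (beta_hat (g t) l - beta_hat (g t) (lam t.+1))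
   (beta_hat (g t) (lam t.+1) - beta_hat (g t.+1) (lam t.+1) +
    (beta_hat (g t.+1) (lam t.+1) - beta_hat (g t.+1) l)).
  rewrite -/C; rewrite -/kap in b1 b2; lra.
have A0 : 0 <= A by exact: l2norm_ge0.
have B0 : 0 <= B by exact: l2norm_ge0.
have C0 : 0 <= C by exact: l2norm_ge0.
have dt0 : 0 <= delta t.+1 by exact: l2norm_ge0.
have A2 : A ^+ 2 <= delta t ^+ 2 / 4.
  have -> : delta t ^+ 2 / 4 = (delta t / 2) ^+ 2 by field.
  by rewrite ler_pXn2r ?nnegrE// divr_ge0 ?l2norm_ge0.
have B2 : B ^+ 2 <= (kap * diam) ^+ 2 by rewrite ler_pXn2r ?nnegrE.
apply: le_trans (sqr_le_of_triple dt0 tri) _.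
have -> : delta t ^+ 2 / 2 + 4 * kap ^+ 2 * diam ^+ 2 + 4 * kap ^+ 2 * s =
    2 * (delta t ^+ 2 / 4) + 4 * (kap * diam) ^+ 2 + 4 * (kap ^+ 2 * s) by field.
by rewrite !lerD// ler_wpM2l.
Qed.

Lemma tracking_error_sum :
  \sum_(1 <= t < T.+1) delta t ^+ 2 <=
    2 * delta 1%N ^+ 2 + 8 * T%:R * kap ^+ 2 * diam ^+ 2 + 8 * kap ^+ 2 * H2 X g T.
Proof.
pose Hs t := 4 * kap ^+ 2 *
  sup [set l2norm (beta_hat (g t.-1) l - beta_hat (g t) l) ^+ 2 | l in X].
have c0 : 0 <= 4 * kap ^+ 2 * diam ^+ 2 by rewrite -mulrA mulr_ge0// -exprMn sqr_ge0.
have := @halving_recurrence_sum _ (fun t => delta t ^+ 2) Hs _ _ T T_gt0 (lexx _)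
  tracking_error_step (fun t => sqr_ge0 _) c0.
move=> /le_trans; apply; rewrite /Hs -mulr_sumr -/(H2 X g T).
by rewrite le_eqVlt; apply/orP; left; apply/eqP; ring.
Qed.

Lemma hypergrad_err_ge0 b : 0 <= b -> 0 <= hypergrad_err lf0 lf1 lg1 lg2 mu eta K b.
Proof.
move=> b0; have k0 := kap_ge0; have e0 := ltW eta_gt0.
have qn n : 0 <= q ^+ n by rewrite exprn_ge0// ltW.
by rewrite addr_ge0 ?mulr_ge0 ?addr_ge0 ?mulr_ge0 ?invr_ge0 ?ler0n ?qn// ltW.
Qed.

(** Written with u = q^K and v = K eta mu q^(K-1), the coefficients of the error are those bounded
    by M. From u^2 <= 1/T and v^2 <= 4/T follows (u + v)^2 <= 10/T; the truncation term keeps u <=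
    1/T and gains 1/T^2. *)
Lemma hypergrad_err_sqr_le M b : 0 <= b ->
  lf1 * (1 + kap) <= M -> lf0 * lg2 / mu * (1 + kap) <= M ->
  hypergrad_err lf0 lf1 lg1 lg2 mu eta K b ^+ 2 <=
    20 * M ^+ 2 / T%:R * b ^+ 2 + 2 * kap ^+ 2 * lf0 ^+ 2 / T%:R ^+ 2.
Proof.
move=> b0 M1 M2; set n := K.-1; set iT := T%:R^-1.
have iT0 : 0 <= iT by rewrite invr_ge0.
have iT1 : iT <= 1 by rewrite invf_le1 ?ltr0n// ler1n.
have qn0 : 0 <= q ^+ n by rewrite exprn_ge0// ltW.
have qK0 : 0 <= q ^+ K by rewrite exprn_ge0// ltW.
have P0 : 0 <= lf1 * (1 + kap) by rewrite mulr_ge0// addr_ge0.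
have P0' : 0 <= lf0 * lg2 / mu * (1 + kap) by rewrite !mulr_ge0 ?invr_ge0 ?addr_ge0// ltW.
have M0 : 0 <= M by exact: le_trans M1.
pose u := q ^+ K; pose v := K%:R * (eta * mu) * q ^+ n.
have u2 : u ^+ 2 <= iT.
  have qK' : u <= iT := qK.
  by rewrite expr2 -[leRHS]mulr1; exact: (ler_pM qK0 qK0 qK' (le_trans qK' iT1)).
have v2 : v ^+ 2 <= 4 * iT.
  have [K0|K0] := posnP K; first by rewrite /v K0 !mul0r expr0n mulr_ge0.
  have em01 : 0 <= eta * mu <= 1 by rewrite mulr_ge0 ?ltW.
  have := natmul_geometric_sqr_le n em01; rewrite prednK//.
  by move=> /le_trans; apply; rewrite ler_wpM2l.
have errE : hypergrad_err lf0 lf1 lg1 lg2 mu eta K b =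
    (lf1 * (1 + kap) * u + lf0 * lg2 / mu * (1 + kap) * v) * b + kap * lf0 * u.
  by rewrite /hypergrad_err -/q -/n -/kap /u /v; field; rewrite gt_eqF.
have u0 : 0 <= u by [].
have v0 : 0 <= v.
  exact: (mulr_ge0 (mulr_ge0 (ler0n _ _) (ltW (mulr_gt0 eta_gt0 mu_gt0))) qn0).
set a := lf1 * (1 + kap) * u + lf0 * lg2 / mu * (1 + kap) * v in errE.
have a0 : 0 <= a by rewrite addr_ge0// mulr_ge0.
have a_le : a <= M * (u + v) by rewrite mulrDr lerD// ler_wpM2r.
have a2 : a ^+ 2 <= 10 * M ^+ 2 * iT.
  apply: (@le_trans _ _ ((M * (u + v)) ^+ 2)).
    by rewrite ler_pXn2r ?nnegrE// mulr_ge0// addr_ge0.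
  have uv2 : (u + v) ^+ 2 <= 10 * iT by have := sqr_ge0 (u - v); move: u2 v2; lra.
  have -> : 10 * M ^+ 2 * iT = M ^+ 2 * (10 * iT) by ring.
  by rewrite exprMn ler_wpM2l ?sqr_ge0.
rewrite errE; apply: (@le_trans _ _ (2 * (a ^+ 2 * b ^+ 2) + 2 * (kap * lf0 * u) ^+ 2)).
  by rewrite -exprMn; have := sqr_ge0 (a * b - kap * lf0 * u); lra.
apply: lerD.
  have := ler_wpM2r (sqr_ge0 b) a2; rewrite -/iT; lra.
have u2' : u ^+ 2 <= iT ^+ 2 by rewrite ler_pXn2r ?nnegrE.
have -> : 2 * (kap * lf0 * u) ^+ 2 = 2 * kap ^+ 2 * lf0 ^+ 2 * u ^+ 2 by ring.
by rewrite -exprVn -/iT ler_wpM2l// -mulrA mulr_ge0// -exprMn sqr_ge0.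
Qed.

(** The factor 1/T cancels the T kap^2 diam^2 of the tracking errors, and the T truncation terms of
    order 1/T^2 stay bounded. *)
Lemma hypergrad_err_sum_le M :
  lf1 * (1 + kap) <= M -> lf0 * lg2 / mu * (1 + kap) <= M ->
  \sum_(1 <= t < T.+1) hypergrad_err lf0 lf1 lg1 lg2 mu eta K (delta t) ^+ 2 <=
    40 * M ^+ 2 * delta 1%N ^+ 2 + 160 * M ^+ 2 * kap ^+ 2 * diam ^+ 2
    + 160 * M ^+ 2 * (kap ^+ 2 * H2 X g T) + 2 * kap ^+ 2 * lf0 ^+ 2.
Proof.
move=> M1 M2; have TR : 0 < T%:R :> R by rewrite ltr0n.
have T1 : 1 <= T%:R :> R by rewrite ler1n.
have H20 : 0 <= H2 X g T.
  by apply: sumr_ge0 => t _; apply: sup_nonneg => _ [l _ <-]; exact: sqr_ge0.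
apply: le_trans (ler_sum _ (fun t _ =>
  @hypergrad_err_sqr_le M (delta t) (l2norm_ge0 _) M1 M2)) _.
rewrite big_split /= -mulr_sumr sumr_const_nat subn1 /= -[X in _ + X]mulr_natl.
have c0 : 0 <= 20 * M ^+ 2 / T%:R by rewrite divr_ge0// mulr_ge0// sqr_ge0.
apply: le_trans (lerD (ler_wpM2l c0 tracking_error_sum) (lexx _)) _.
set iT := T%:R^-1.
have iT0 : 0 <= iT by rewrite invr_ge0 ltW.
have iT1 : iT <= 1 by rewrite invf_le1.
have iTT : T%:R * iT = 1 by rewrite mulfV// gt_eqF.
have -> : 20 * M ^+ 2 / T%:R * (2 * delta 1%N ^+ 2 + 8 * T%:R * kap ^+ 2 * diam ^+ 2
      + 8 * kap ^+ 2 * H2 X g T) + T%:R * (2 * kap ^+ 2 * lf0 ^+ 2 / T%:R ^+ 2) =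
    iT * (40 * M ^+ 2 * delta 1%N ^+ 2) + 160 * M ^+ 2 * kap ^+ 2 * diam ^+ 2
    + iT * (160 * M ^+ 2 * (kap ^+ 2 * H2 X g T)) + iT * (2 * kap ^+ 2 * lf0 ^+ 2).
  by rewrite /iT; field; rewrite gt_eqF.
have le_iT z : 0 <= z -> iT * z <= z by move=> z0; rewrite ler_piMl.
have pos1 : 0 <= 40 * M ^+ 2 * delta 1%N ^+ 2 by rewrite -mulrA mulr_ge0// -exprMn sqr_ge0.
have pos2 : 0 <= 160 * M ^+ 2 * (kap ^+ 2 * H2 X g T).
  by rewrite mulrA mulr_ge0// -mulrA mulr_ge0// -exprMn sqr_ge0.
have pos3 : 0 <= 2 * kap ^+ 2 * lf0 ^+ 2 by rewrite -mulrA mulr_ge0// -exprMn sqr_ge0.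
by rewrite !lerD ?le_iT.
Qed.

End OBBORun.

Unset Implicit Arguments.

(* The constant C hidden in O(.) does not depend on T, w, the functions f_t,
   g_t, phi_t (hence not on V_{1,T} and H_{2,T}), nor on l_{g,1} and mu_g (hence
   not on kappa_g).  It may depend on the other constants, on X, h, lambda_1, on
   a bound B on the initial inner error and on a bound r on the ratio w / T.
   The latter is needed: if T = 1, F_1 = F_2 = 0 and h is not minimal at
   lambda_1, the regret is a positive constant while the rate is 1 / w. *)
Theorem theorem5p2
  (R : realType) (d1 d2 : nat)
  (X : set 'cV[R]_d1) (h : 'cV[R]_d1 -> R) (lam1 : 'cV[R]_d1)
  (lf0 lf1 lg2 rho diam Q eta alpha B r : R)
  (X_closed : closed X) (X_convex : convex_set X)
  (X_diam : forall l l', X l -> X l' -> l2norm (l - l') <= diam)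
  (h_convex : convex_function X h)
  (lf0_ge0 : 0 <= lf0) (lf1_gt0 : 0 < lf1) (lg2_ge0 : 0 <= lg2)
  (rho_gt0 : 0 < rho) (eta_gt0 : 0 < eta) (alpha_gt0 : 0 < alpha) :
  exists2 C : R, 0 < C &
  forall (lg1 mu : R) (T w K : nat)
    (f g : nat -> 'cV[R]_(d1 + d2) -> R)
    (df dg : nat -> 'cV[R]_(d1 + d2) -> 'cV[R]_(d1 + d2))
    (dglb : nat -> 'cV[R]_(d1 + d2) -> 'M[R]_(d1, d2))
    (dgbb : nat -> 'cV[R]_(d1 + d2) -> 'M[R]_d2)
    (phi : nat -> 'cV[R]_d1 -> R) (dphi : nat -> 'cV[R]_d1 -> 'cV[R]_d1)
    (lam : nat -> 'cV[R]_d1) (beta : nat -> 'cV[R]_d2),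
  0 < lg1 -> 0 < mu -> (1 <= T)%N -> (1 <= w)%N -> w%:R <= r * T%:R ->
  (forall t, (1 <= t <= T.+1)%N ->
    [/\ outer_regular X lf0 lf1 (f t) (df t),
        inner_regular X lg1 lg2 (g t) (dg t) (dglb t) (dgbb t),
        forall l, X l -> strongly_convex_on setT mu (fun b => g t (col_mx l b))
      & forall l, X l -> `|outer_obj (f t) (g t) l| <= Q]) ->
  (forall t, (1 <= t <= T)%N ->
    [/\ forall l, X l -> is_grad_on X (phi t) l (dphi t l),
        {within X, continuous (dphi t)}
      & strongly_convex_on X rho (phi t)]) ->
  eta < Num.min lg1^-1 mu^-1 ->
  alpha <= Num.min
    (3 * rho / (4 * lF1 lf0 lf1 lg1 lg2 mu))
    (rho * Num.sqrt (1 - nu mu eta K) /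
      (kappa lg1 mu *
       Num.sqrt (108 * Cmu mu eta * Lbeta lf0 lg1 lg2 mu eta K))) ->
  K%:Z = Num.ceil (ln T%:R / ln (1 - eta * mu)^-1 : R) + 1 ->
  obbo X h phi dphi df dg dglb dgbb eta alpha T w K lam beta ->
  lam 1%N = lam1 ->
  l2norm (beta 1%N - beta_hat (g 1%N) lam1) <= B ->
  BLR X h phi dphi f g alpha T w lam <=
    C * (T%:R / w%:R + V1 X f g T + kappa lg1 mu ^+ 2 * H2 X g T).
Proof.
have [m hm] := convex_function_lower_bound X_convex X_diam h_convex.
(* M bounds l_{F,1} by the step size condition, and kb bounds kappa through lf1 (1 + kappa) <= M;
   neither mentions lg1 or mu. P1 stands for the displacement, P2 for the decrease of h, P3 and P4
   for the hypergradient error. Absolute values keep C positive before X is known to be nonempty and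
   r to be positive. *)
pose M := 3 * rho / (4 * alpha); pose kb := M / lf1.
pose c1 := 4 / (alpha * rho); pose c2 := 4 / rho ^+ 2.
pose P1 := lf0 * (1 + kb) * `|diam|; pose P2 := `|h lam1 - m| * `|r|.
pose Z := 40 * M ^+ 2 * B ^+ 2 + 160 * M ^+ 2 * kb ^+ 2 * diam ^+ 2
  + 2 * kb ^+ 2 * lf0 ^+ 2.
pose P3 := `|r| * Z.
pose P4 := 160 * M ^+ 2.
have M0 : 0 < M by rewrite divr_gt0 ?mulr_gt0.
have kb0 : 0 < kb by rewrite divr_gt0.
have c10 : 0 < c1 by rewrite divr_gt0 ?mulr_gt0.
have c20 : 0 < c2 by rewrite divr_gt0 ?exprn_gt0.
have P10 : 0 <= P1 by rewrite mulr_ge0// mulr_ge0// addr_ge0// ltW.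
have P20 : 0 <= P2 by rewrite mulr_ge0.
have sqr3 (a b c : R) : 0 <= a -> 0 <= a * b ^+ 2 * c ^+ 2.
  by move=> a0; rewrite -mulrA mulr_ge0// -exprMn sqr_ge0.
have Z0 : 0 <= Z by rewrite !addr_ge0 ?sqr3// mulr_ge0 ?sqr_ge0.
have P30 : 0 <= P3 by exact: mulr_ge0.
have P40 : 0 <= P4 by rewrite mulr_ge0 ?sqr_ge0.
pose C := c1 * (P1 + P2) + c2 * (P3 + P4) + 1.
have C0 : 0 < C by rewrite ltr_wpDl// addr_ge0// mulr_ge0 ?addr_ge0// ltW.
exists C => // lg1 mu T w K f g df dg dglb dgbb phi dphi lam beta.
move=> lg10 mu0 T0 w0 wr reg phiP.
rewrite lt_min => /andP[eta_lg eta_mu].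
rewrite le_min => /andP[alphaF _] KE run lamE betaB.
have eta_lg1 : eta * lg1 <= 1 by rewrite -ler_pdivlMr// div1r ltW.
have eta_mu1 : eta * mu < 1 by rewrite -ltr_pdivlMr// div1r.
have reg' t : (1 <= t <= T.+1)%N -> [/\ outer_regular X lf0 lf1 (f t) (df t),
      inner_regular X lg1 lg2 (g t) (dg t) (dglb t) (dgbb t)
    & forall l, X l -> strongly_convex_on setT mu (fun b => g t (col_mx l b))].
  by move=> /reg[].
have lf10 := ltW lf1_gt0.
set k := kappa lg1 mu.
have k0 : 0 <= k by rewrite divr_ge0 ?ltW.
have em0 : 0 < eta * mu by rewrite mulr_gt0.
have q01 : 0 < 1 - eta * mu < 1 by apply/andP; split; lra.
have K_large := inner_steps_geometric q01 T0 KE.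
have X1 : X (lam 1%N) := run.1.
have diam0 : 0 <= diam by rewrite (le_trans (l2norm_ge0 _) (X_diam _ _ X1 X1)).
(* Both are summands of l_{F,1}, whose other summands are nonnegative. *)
have [F1 F2] : lf1 * (1 + k) <= M /\ lf0 * lg2 / mu * (1 + k) <= M.
  have a1 : 0 < lf1 * (1 + k) by rewrite mulr_gt0//; lra.
  have a2 : 0 <= lf0 * lg2 / mu * (1 + k).
    by rewrite mulr_ge0 ?addr_ge0// divr_ge0 ?mulr_ge0// ltW.
  have a3 : 0 <= Mf lf0 lf1 lg1 lg2 mu * k.
    rewrite mulr_ge0// /Mf -/k !addr_ge0//; exact: mulr_ge0.
  have : lF1 lf0 lf1 lg1 lg2 mu <= M.
    have F0 : 0 < lF1 lf0 lf1 lg1 lg2 mu by rewrite /lF1 -/k; lra.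
    move: alphaF; rewrite /M !ler_pdivlMr ?mulr_gt0// => h1; lra.
  by rewrite /lF1 -/k; split; lra.
have k_kb : k <= kb by rewrite ler_pdivlMr//; have := F1; lra.
pose delta t := l2norm (beta t - beta_hat (g t) (lam t)).
pose E t := hypergrad_err lf0 lf1 lg1 lg2 mu eta K (delta t).
have E0 t : 0 <= E t.
  by apply: hypergrad_err_ge0; rewrite ?l2norm_ge0.
pose G := lf0 * (1 + k).
have G0 : 0 <= G by rewrite mulr_ge0// addr_ge0.
have Xlam t : (1 <= t <= T)%N -> X (lam t).
  by move=> /andP[t1 tT]; apply: (obbo_mem run); rewrite t1 leqW.
have tT1 t : (1 <= t <= T)%N -> (1 <= t <= T.+1)%N by move=> /andP[-> /leqW].
pose p s := grad_on X (outer_obj (f s) (g s)) (lam s).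
pose ph s := hypergrad (df s) (dg s) (dglb s) (dgbb s) eta K (lam s) (beta s).
have p_eq t y y' : (1 <= t <= T)%N -> X y -> X y' -> dotp (p t) (y - y') =
    dotp (implicit_grad (g t) (df t) (dglb t) (dgbb t) (lam t)) (y - y').
  move=> tT Xy Xy'; have [f_reg g_reg g_sc] := reg' t (tT1 t tT).
  exact: (dotp_grad_on_outer_obj X_convex f_reg g_reg g_sc lg10 mu0 eta_gt0 eta_lg1
    eta_mu1 (Xlam t tT) Xy Xy').
have p_le t y y' : (1 <= t <= T)%N -> X y -> X y' ->
    dotp (p t) (y - y') <= G * l2norm (y - y').
  move=> tT Xy Xy'; have [f_reg g_reg g_sc] := reg' t (tT1 t tT).
  rewrite p_eq//.
  exact: (implicit_grad_bound X_convex f_reg g_reg g_sc lf0_ge0 lf10 lg2_ge0 lg10 mu0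
    (Xlam t tT) Xy Xy').
have ph_le t y y' : (1 <= t <= T)%N -> X y -> X y' ->
    dotp (ph t - p t) (y - y') <= E t * l2norm (y - y').
  move=> tT Xy Xy'; have [f_reg g_reg g_sc] := reg' t (tT1 t tT).
  rewrite dotpBl p_eq// -dotpBl.
  exact: (hypergrad_error X_convex f_reg g_reg g_sc lf0_ge0 lf10 lg2_ge0 lg10 mu0 eta_gt0
    eta_lg1 eta_mu1 (beta t) K (Xlam t tT) Xy Xy').
have step t : (1 <= t <= T)%N ->
    [/\ forall l, X l -> is_grad_on X (phi t) l (dphi t l),
        strongly_convex_on X rho (phi t)
      & is_argmin X (prox_obj h (phi t) (dphi t) alpha (lam t) (window_avg w ph t))
          (lam t.+1)].
  by move=> tT; have [gradphi _ scphi] := phiP t tT; split=> //; have [] := run.2 t tT.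
apply: le_trans (prox_regret_le X_convex h_convex rho_gt0 alpha_gt0 w0 X_diam hm G0 E0
  X1 step p_le ph_le) _.
have := hypergrad_err_sum_le X_diam lf0_ge0 lf10 lg2_ge0 lg10 mu0 eta_gt0
  eta_lg1 eta_mu1 T0 reg' run K_large F1 F2.
rewrite -/k -/(delta 1%N); set SE := \sum_(_ <= _ < _) _ => SE_le.
have H20 : 0 <= H2 X g T.
  by apply: sumr_ge0 => t _; apply: sup_nonneg => _ [l _ <-]; exact: sqr_ge0.
have V10 : 0 <= V1 X f g T.
  by apply: sumr_ge0 => t _; apply: sup_nonneg => _ [l _ <-].
have dB : delta 1%N ^+ 2 <= B ^+ 2.
  have dle : delta 1%N <= B by rewrite /delta lamE.
  by rewrite ler_pXn2r ?nnegrE ?l2norm_ge0// (le_trans (l2norm_ge0 _) dle).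
have kk : k ^+ 2 <= kb ^+ 2 by rewrite ler_pXn2r ?nnegrE// ltW.
set TW := T%:R / w%:R; set KH := k ^+ 2 * H2 X g T in SE_le *.
have wR : 0 < w%:R :> R by rewrite ltr0n.
have TR : 0 < T%:R :> R by rewrite ltr0n.
have TW0 : 0 < TW by rewrite divr_gt0.
have KH0 : 0 <= KH by rewrite mulr_ge0 ?sqr_ge0.
have rTW : 1 <= `|r| * TW.
  rewrite mulrA ler_pdivlMr// mul1r (le_trans wr)// ler_wpM2r ?ler_norm// ltW.
have scale_le z : 0 <= z -> z <= `|r| * z * TW.
  by move=> z0; rewrite mulrAC -[leLHS]mul1r ler_wpM2r.
have part1 : TW * (G * diam) + (h (lam 1%N) - m) <= (P1 + P2) * TW.
  rewrite mulrDl; apply: lerD.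
    rewrite mulrC ler_wpM2r ?(ltW TW0)// /P1 ger0_norm// ler_wpM2r//.
    by rewrite ler_wpM2l// lerD2l.
  rewrite lamE (le_trans (ler_norm _))// /P2 mulrC [_ * `|r|]mulrC.
  by rewrite mulrC scale_le.
have part2 : SE <= P3 * TW + P4 * KH.
  apply: le_trans SE_le _.
  have e1 : 40 * M ^+ 2 * delta 1%N ^+ 2 <= 40 * M ^+ 2 * B ^+ 2.
    by rewrite ler_wpM2l// mulr_ge0 ?sqr_ge0.
  have e2 : 160 * M ^+ 2 * k ^+ 2 * diam ^+ 2 <= 160 * M ^+ 2 * kb ^+ 2 * diam ^+ 2.
    by rewrite ler_wpM2r ?sqr_ge0// ler_wpM2l// mulr_ge0 ?sqr_ge0.
  have e3 : 2 * k ^+ 2 * lf0 ^+ 2 <= 2 * kb ^+ 2 * lf0 ^+ 2.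
    by rewrite ler_wpM2r ?sqr_ge0// ler_wpM2l.
  by have := scale_le Z Z0; rewrite -/P3 {1}/Z /P4; lra.
apply: (@le_trans _ _ (c1 * ((P1 + P2) * TW) + c2 * (P3 * TW + P4 * KH))).
  by apply: lerD; rewrite ler_wpM2l// ltW.
have hTW : (c1 * (P1 + P2) + c2 * P3) * TW <= C * TW.
  rewrite ler_wpM2r ?(ltW TW0)//.
  have -> : C = c1 * (P1 + P2) + c2 * P3 + (c2 * P4 + 1) by rewrite /C; ring.
  by rewrite lerDl addr_ge0// mulr_ge0// ltW.
have hKH : c2 * P4 * KH <= C * KH.
  rewrite ler_wpM2r//.
  have -> : C = c2 * P4 + (c1 * (P1 + P2) + c2 * P3 + 1) by rewrite /C; ring.
  by rewrite lerDl !addr_ge0// mulr_ge0 ?addr_ge0// ltW.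
have hV : 0 <= C * V1 X f g T by rewrite mulr_ge0// ltW.
move: hTW hKH hV; lra.
Qed.
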